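(* Let $f_0:\mathbb{R}^n\to\mathbb{R}$ and $F:\mathbb{R}^n\to\mathbb{R}^m$ be twice continuously differentiable, $g:\mathbb{R}^m\to\overline{\mathbb{R}}$ lower semicontinuous proper convex, and $f:=f_0+g\circ F$. Let $\bar x\in\operatorname{dom}(g\circ F)$ be a tilt-stable local minimizer of $f$ with modulus $\kappa>0$ satisfying the KKT conditions (there is $\mu\in\partial g(F(\bar x))$ with $\nabla_xL(\bar x,\mu)=0$). Assume: (1) there is a neighborhood of $\bar x$ such that for every $x$ in it and every $\mu\in\partial g(F(x))$, $g$ is parabolically regular at $F(x)$ for $\mu$ and parabolically epi-differentiable at $F(x)$ for every $d$ with $dg(F(x))(d)=\langle\mu,d\rangle$; (2) $g$ is locally Lipschitz around $F(\bar x)$ relative to $\operatorname{dom}g$ with constant $\ell\ge0$, and there are $\kappa_0>0$ and a neighborhood $\mathcal{U}$ of $\bar x$ with $\operatorname{dist}(x',\operatorname{dom}(g\circ F))\le\kappa_0\operatorname{dist}(F(x'),\operatorname{dom}g)$ for all $x'\in\mathcal{U}$; (3) for every $\mu\in\partial g(F(\bar x))$ there exists $\overline{W}=\overline W_\mu\in\partial_B\operatorname{Prox}_g(F(\bar x)+\mu)$ with $\bigcup_{V\in\mathcal{J}\operatorname{Prox}_g(F(\bar x)+\mu)}\operatorname{rge}V=\operatorname{rge}\overline{W}$ such that every $y$ in this union satisfies $y=\overline{W}\bar z$ for some $\bar z$ with $\min_{z\in\mathbb{R}^m,\,y=Vz,\,V\in\mathcal{J}\operatorname{Prox}_g(F(\bar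 x)+\mu)}\langle y,z-y\rangle=\langle y,\bar z-y\rangle=\langle y,(\overline{W}^\dagger-I)y\rangle$; (4) for any nonzero $w\in\mathcal{K}(\bar x,-\nabla f_0(\bar x))$, any $\mu\in\Lambda(\bar x,-\nabla f_0(\bar x);w)\cap\tau(\bar x,-\nabla f_0(\bar x))\mathbb{B}_{\mathbb{R}^m}$ and any $v$ with $\nabla F(\bar x)v\in\operatorname{dom}\Gamma_g(F(\bar x),\mu)$, there exist $(x^k,\mu^k)\to(\bar x,\mu)$ with $\mu^k\in\partial g(F(x^k))$, $z^k\to(\overline{W}_\mu^\dagger-I)\nabla F(\bar x)v$ and $v^k\to v$ such that $(z^k,-\nabla F(x^k)v^k)\in\widehat{\mathcal{N}}_{\operatorname{gph}\partial g}(F(x^k),\mu^k)$ and $\Lambda(x^k,\nabla F(x^k)^T\mu^k)$ is a singleton. Then $$\langle v,\nabla^2_{xx}L(\bar x,\mu)v\rangle+\Gamma_g(F(\bar x),\mu)(\nabla F(\bar x)v)\ge\frac1\kappa\|v\|^2\quad\text{for all } v\neq0 \text{ with } \nabla F(\bar x)v\in\bigcup_{V\in\mathcal{J}\operatorname{Prox}_g(F(\bar x)+\mu)}\operatorname{rge}V$$ for every $\mu\in\bigcup_{0\neq w\in\mathcal{K}(\bar x,-\nabla f_0(\bar x))}\Lambda(\bar x,-\nabla f_0(\bar x);w)\cap\tau(\bar x,-\nabla f_0(\bar x))\mathbb{B}_{\mathbb{R}^m}$.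
   Context: $L(x,\mu):=f_0(x)+\langle F(x),\mu\rangle$. $dg(y)(d):=\liminf_{t\downarrow0,\,d'\to d}\frac{g(y+td')-g(y)}{t}$; $d^{2}g(y,\mu)(d):=\liminf_{\tau\downarrow0,\,d'\to d}\frac{g(y+\tau d')-g(y)-\tau\langle \mu,d'\rangle}{\tau^2/2}$; for $d$ with $dg(y)(d)$ finite, $d^{2}g(y)(d,w):=\liminf_{t\downarrow0,\,w'\to w}\frac{g(y+td+\frac12t^2w')-g(y)-t\,dg(y)(d)}{t^2/2}$. Parabolic epi-differentiability at $y$ for $d$: $\operatorname{dom}d^2g(y)(d,\cdot)\neq\emptyset$ and for every $w$, $t_k\downarrow0$ there are $w_k\to w$ with $d^2g(y)(d,w)=\lim_k\frac{g(y+t_kd+\frac12t_k^2w_k)-g(y)-t_k\,dg(y)(d)}{t_k^2/2}$; parabolic regularity at $y$ for $\mu$: $\inf_w\{d^2g(y)(d,w)-\langle\mu,w\rangle\}=d^2g(y,\mu)(d)$ for all $d$. $\widehat{\mathcal{N}}_C$ is the Fréchet regular normal cone. $\operatorname{Prox}_g(y):=\operatorname{argmin}_z\{g(z)+\frac12\|z-y\|^2\}$; $\partial_B$ B-subdifferential, $\mathcal{J}:=\operatorname{conv}\partial_B$; $\operatorname{rge}V$ range, $V^\dagger$ Moore–Penrose inverse. SOVF: $\Gamma_g(y,\mu)(v):=\min_{d,\,v=Vd,\,V\in\mathcal{J}\operatorname{Prox}_g(y+\mu)}\langle v,d-v\rangle$ if $v\in\bigcup_{V\in\mathcal{J}\operatorname{Prox}_g(y+\mu)}\operatorname{rge}V$,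 $\infty$ otherwise; its domain is where it is finite. For $x^*\in\nabla F(x)^T\partial g(F(x))$: $\Lambda(x,x^* ):=\{\mu\in\partial g(F(x))\mid x^*=\nabla F(x)^T\mu\}$; $\mathcal{K}(x,x^* ):=\{d\mid dg(F(x))(\nabla F(x)d)=\langle x^*,d\rangle\}$; for $v\in\mathcal{K}(x,x^* )$, $\Lambda(x,x^*;v):=\operatorname{argmax}_{\mu\in\Lambda(x,x^* )}(\langle\mu,\nabla^2F(x)(v,v)\rangle+d^2g(F(x),\mu)(\nabla F(x)v))$ with $\nabla^2F(x)(v,v)_i=v^T\nabla^2F_i(x)v$; $\tau(x,x^* ):=\kappa_0\ell\|\nabla F(x)\|+\kappa_0\|x^*\|+\ell$. $\bar x$ is a tilt-stable local minimizer of $f$ with modulus $\kappa$ if for some $\delta>0$ the map $M_\delta(u):=\operatorname{argmin}_{\|x'-\bar x\|\le\delta}\{f(x')-f(\bar x)-\langle u,x'-\bar x\rangle\}$ is single-valued and Lipschitz with modulus $\kappa$ on a neighborhood of $u=0$ and $M_\delta(0)=\{\bar x\}$. *)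

(* Defs.v *)
From HB Require Import structures.
From mathcomp Require Import all_boot all_order all_algebra.
From mathcomp Require Import boolp classical_sets reals constructive_ereal ereal.
From mathcomp Require Import Rstruct.

Set Implicit Arguments.
Unset Strict Implicit.
Unset Printing Implicit Defensive.

Import Order.TTheory GRing.Theory Num.Theory.
Local Open Scope classical_set_scope.
Local Open Scope ring_scope.

Notation RR := Rdefinitions.R.
Notation vec n := 'cV[RR]_n.

Definition dotv {n} (u v : vec n) : RR := \sum_(i < n) u i 0 * v i 0.
Definition normv {n} (u : vec n) : RR := Num.sqrt (dotv u u).
Definition normp {m p} (a : vec m) (b : vec p) : RR := Num.sqrt (dotv a a + dotv b b).
Definition opnorm {m n} (A : 'M[RR]_(m, n)) : RR :=
  sup [set normv (A *m d) | d in [set d : vec n | normv d <= 1]].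

Definition cvg_rseq (u : nat -> RR) (l : RR) :=
  forall e : RR, 0 < e -> exists N, forall k, (N <= k)%N -> `|u k - l| < e.
Definition cvg_vseq {n} (u : nat -> vec n) (l : vec n) :=
  forall e : RR, 0 < e -> exists N, forall k, (N <= k)%N -> normv (u k - l) < e.
Definition cvg_mseq {m n} (u : nat -> 'M[RR]_(m, n)) (l : 'M[RR]_(m, n)) :=
  forall i j, cvg_rseq (fun k => u k i j) (l i j).
Definition cvg_eseq (u : nat -> \bar RR) (l : \bar RR) :=
  match l with
  | EFin r => forall e : RR, 0 < e -> exists N, forall k, (N <= k)%N ->
                 u k \is a fin_num /\ `|fine (u k) - r| < e
  | +oo%E => forall M : RR, exists N, forall k, (N <= k)%N -> (M%:E < u k)%E
  | -oo%E => forall M : RR, exists N, forall k, (N <= k)%N -> (u k < M%:E)%E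
  end.

Definition contv {n} (h : vec n -> RR) (x : vec n) :=
  forall e : RR, 0 < e -> exists d : RR, 0 < d /\
    forall y, normv (y - x) < d -> `|h y - h x| < e.
Definition has_grad_at {n} (h : vec n -> RR) (x : vec n) (gr : vec n) :=
  forall e : RR, 0 < e -> exists d : RR, 0 < d /\
    forall u, normv u < d -> `|h (x + u) - h x - dotv gr u| <= e * normv u.
Definition has_deriv_at {n p} (G : vec n -> vec p) (x : vec n) (A : 'M[RR]_(p, n)) :=
  forall e : RR, 0 < e -> exists d : RR, 0 < d /\
    forall u, normv u < d -> normv (G (x + u) - G x - A *m u) <= e * normv u.
Definition C2_scalar {n} (f0 : vec n -> RR) (gf0 : vec n -> vec n)
    (Hf0 : vec n -> 'M[RR]_n) :=
  (forall x, has_grad_at f0 x (gf0 x)) /\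
  (forall x, has_deriv_at gf0 x (Hf0 x)) /\
  (forall x i j, contv (fun y => Hf0 y i j) x).
Definition C2_vector {n m} (F : vec n -> vec m) (JF : vec n -> 'M[RR]_(m, n))
    (HF : vec n -> 'I_m -> 'M[RR]_n) :=
  (forall x, has_deriv_at F x (JF x)) /\
  (forall x (i : 'I_m), has_deriv_at (fun y => (row i (JF y))^T) x (HF x i)) /\
  (forall x i j k, contv (fun y => HF y i j k) x).

Definition domg {m} (g : vec m -> \bar RR) : set (vec m) := [set y | (g y < +oo)%E].
Definition proper_fun {m} (g : vec m -> \bar RR) :=
  (forall y, (-oo < g y)%E) /\ exists y, (g y < +oo)%E.
Definition lsc_fun {m} (g : vec m -> \bar RR) :=
  forall y (r : RR), (r%:E < g y)%E -> exists d : RR, 0 < d /\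
    forall z, normv (z - y) < d -> (r%:E < g z)%E.
Definition convex_fun {m} (g : vec m -> \bar RR) :=
  forall x y (t : RR), 0 <= t <= 1 -> (g x < +oo)%E -> (g y < +oo)%E ->
    (g (t *: x + (1 - t) *: y)%R <= t%:E * g x + (1 - t)%:E * g y)%E.
Definition subdiff {m} (g : vec m -> \bar RR) (y : vec m) : set (vec m) :=
  [set mu | g y \is a fin_num /\ forall z, (g y + (dotv mu (z - y)%R)%:E <= g z)%E].
Definition gph_subdiff {m} (g : vec m -> \bar RR) : set (vec m * vec m) :=
  [set p | subdiff g p.1 p.2].

(* distance (extended-valued, = +oo for the empty set) *)
Definition dist_e {n} (x : vec n) (C : set (vec n)) : \bar RR :=
  ereal_inf [set (normv (x - y))%:E | y in C].

Definition loc_lip_rel {m} (g : vec m -> \bar RR) (y0 : vec m) (ell : RR) :=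
  exists e : RR, 0 < e /\ forall y y', domg g y -> domg g y' ->
    normv (y - y0) < e -> normv (y' - y0) < e ->
    `|fine (g y) - fine (g y')| <= ell * normv (y - y').

Definition liminf2 {m} (Q : RR -> vec m -> \bar RR) (d : vec m) : \bar RR :=
  ereal_sup [set ereal_inf [set r | exists t d', 0 < t < e /\ normv (d' - d) < e
                                       /\ r = Q t d'] | e in [set e : RR | 0 < e]].
Definition subderiv {m} (g : vec m -> \bar RR) (y d : vec m) : \bar RR :=
  liminf2 (fun t d' => ((g (y + t *: d')%R - g y) * (t^-1)%:E)%E) d.
Definition d2sub {m} (g : vec m -> \bar RR) (y mu d : vec m) : \bar RR :=
  liminf2 (fun t d' =>
    ((g (y + t *: d')%R - g y - (t * dotv mu d')%:E) * ((t ^+ 2 / 2)^-1)%:E)%E) d.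
Definition par_quot {m} (g : vec m -> \bar RR) (y d : vec m) (t : RR) (w' : vec m)
  : \bar RR :=
  ((g (y + t *: d + (t ^+ 2 / 2) *: w')%R - g y - (t * fine (subderiv g y d))%:E)
     * ((t ^+ 2 / 2)^-1)%:E)%E.
(* parabolic subderivative d^2 g(y)(d, w) (defined when dg(y)(d) is finite;
   set to +oo otherwise) *)
Definition d2par {m} (g : vec m -> \bar RR) (y d w : vec m) : \bar RR :=
  if subderiv g y d \is a fin_num then liminf2 (par_quot g y d) w else +oo%E.
Definition parabolic_epi {m} (g : vec m -> \bar RR) (y d : vec m) :=
  subderiv g y d \is a fin_num /\
  (exists w, (d2par g y d w < +oo)%E) /\
  forall w (t : nat -> RR), (forall k, 0 < t k) -> cvg_rseq t 0 ->
    exists wk : nat -> vec m, cvg_vseq wk w /\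
      cvg_eseq (fun k => par_quot g y d (t k) (wk k)) (d2par g y d w).
Definition parabolic_regular {m} (g : vec m -> \bar RR) (y mu : vec m) :=
  forall d, (d2sub g y mu d < +oo)%E ->
    ereal_inf [set (d2par g y d w - (dotv mu w)%:E)%E | w in [set: vec m]]
    = d2sub g y mu d.

Definition prox_set {m} (g : vec m -> \bar RR) (y : vec m) : set (vec m) :=
  [set z | forall z', (g z + (normv (z - y) ^+ 2 / 2)%:E
                        <= g z' + (normv (z' - y) ^+ 2 / 2)%:E)%E].
(* Prox_g(y): the (unique, for g proper lsc convex) element of prox_set g y *)
Definition proxf {m} (g : vec m -> \bar RR) (y : vec m) : vec m :=
  xget 0 (prox_set g y).
Definition Bsub {m} (P : vec m -> vec m) (y : vec m) : set 'M[RR]_m :=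
  [set V | exists (yk : nat -> vec m) (Dk : nat -> 'M[RR]_m),
     cvg_vseq yk y /\ (forall k, has_deriv_at P (yk k) (Dk k)) /\ cvg_mseq Dk V].
Definition convM {p q} (S : set 'M[RR]_(p, q)) : set 'M[RR]_(p, q) :=
  [set V | exists k (lam : 'I_k -> RR) (Vs : 'I_k -> 'M[RR]_(p, q)),
     (forall i, 0 <= lam i) /\ \sum_(i < k) lam i = 1 /\ (forall i, S (Vs i)) /\
     V = \sum_(i < k) lam i *: Vs i].
Definition Jprox {m} (g : vec m -> \bar RR) (y : vec m) : set 'M[RR]_m :=
  convM (Bsub (proxf g) y).
Definition rge {m n} (V : 'M[RR]_(m, n)) : set (vec m) := [set V *m d | d in [set: vec n]].
Definition union_rge {m} (g : vec m -> \bar RR) (y : vec m) : set (vec m) :=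
  [set u | exists V, Jprox g y V /\ rge V u].
Definition Gamma {m} (g : vec m -> \bar RR) (y mu v : vec m) : \bar RR :=
  if `[< union_rge g (y + mu) v >] then
    ereal_inf [set (dotv v (d - v))%:E |
                d in [set d | exists V, Jprox g (y + mu) V /\ v = V *m d]]
  else +oo%E.
Definition domGamma {m} (g : vec m -> \bar RR) (y mu : vec m) : set (vec m) :=
  [set v | Gamma g y mu v \is a fin_num].

Definition is_MP {m n} (A : 'M[RR]_(m, n)) (X : 'M[RR]_(n, m)) :=
  A *m X *m A = A /\ X *m A *m X = X /\ (A *m X)^T = A *m X /\ (X *m A)^T = X *m A.
Definition mpinv {m n} (A : 'M[RR]_(m, n)) : 'M[RR]_(n, m) := xget 0 [set X | is_MP A X].

Definition reg_normal {m} (C : set (vec m * vec m)) (p : vec m * vec m)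
    (nv : vec m * vec m) :=
  C p /\ forall e : RR, 0 < e -> exists d : RR, 0 < d /\
    forall q, C q -> normp (q.1 - p.1) (q.2 - p.2) < d ->
      dotv nv.1 (q.1 - p.1) + dotv nv.2 (q.2 - p.2) <= e * normp (q.1 - p.1) (q.2 - p.2).

Definition Lambda {n m} (F : vec n -> vec m) (JF : vec n -> 'M[RR]_(m, n))
    (g : vec m -> \bar RR) (x xs : vec n) : set (vec m) :=
  [set mu | subdiff g (F x) mu /\ xs = (JF x)^T *m mu].
Definition Kcone {n m} (F : vec n -> vec m) (JF : vec n -> 'M[RR]_(m, n))
    (g : vec m -> \bar RR) (x xs : vec n) : set (vec n) :=
  [set d | subderiv g (F x) (JF x *m d) = (dotv xs d)%:E].
Definition hessq {n m} (HF : vec n -> 'I_m -> 'M[RR]_n) (x v : vec n) : vec m :=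
  \col_(i < m) (v^T *m HF x i *m v) 0 0.
Definition LambdaV {n m} (F : vec n -> vec m) (JF : vec n -> 'M[RR]_(m, n))
    (HF : vec n -> 'I_m -> 'M[RR]_n) (g : vec m -> \bar RR) (x xs v : vec n)
    : set (vec m) :=
  let val mu := ((dotv mu (hessq HF x v))%:E + d2sub g (F x) mu (JF x *m v))%E in
  [set mu | Lambda F JF g x xs mu /\
            forall mu', Lambda F JF g x xs mu' -> (val mu' <= val mu)%E].
Definition tau {n m} (JF : vec n -> 'M[RR]_(m, n)) (k0 ell : RR) (x xs : vec n) : RR :=
  k0 * ell * opnorm (JF x) + k0 * normv xs + ell.
Definition hessL {n m} (Hf0 : vec n -> 'M[RR]_n) (HF : vec n -> 'I_m -> 'M[RR]_n)
    (x : vec n) (mu : vec m) : 'M[RR]_n :=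
  Hf0 x + \sum_(i < m) mu i 0 *: HF x i.

Definition Mdelta {n} (f : vec n -> \bar RR) (xb : vec n) (delta : RR) (u : vec n)
  : set (vec n) :=
  [set x | normv (x - xb) <= delta /\ forall x', normv (x' - xb) <= delta ->
     (f x - f xb - (dotv u (x - xb)%R)%:E <= f x' - f xb - (dotv u (x' - xb)%R)%:E)%E].
Definition tilt_stable {n} (f : vec n -> \bar RR) (xb : vec n) (kappa : RR) :=
  exists delta : RR, 0 < delta /\ exists e : RR, 0 < e /\ exists M : vec n -> vec n,
    (forall u, normv u < e -> Mdelta f xb delta u = [set M u]) /\
    (forall u u', normv u < e -> normv u' < e ->
        normv (M u - M u') <= kappa * normv (u - u')) /\
    Mdelta f xb delta 0 = [set xb].

(* Main.v *)
(* Tilt stability yields a uniform quadratic growth of f at all pairs (x, y) in gph df near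
   (xb, 0): the convex function theta u = max (<u, x> - f x) has the kappa-Lipschitz
   gradient M, so the descent lemma for theta dualizes to growth of f with constant
   1/(2 kappa), and prox-regularity of f (g is convex, f0 and F are C^2, multipliers are
   bounded) forces M y = x.

   At a point x where the multiplier mu is unique, growth along the parabolic arcs
   x + t w + t^2/2 u, made feasible by the metric qualification, bounds from below the
   parabolic difference quotients of g up to an exact penalty.  A regularized penalty
   problem produces multipliers that converge to the unique one, so that the penalty
   disappears; parabolic regularity then gives
     <w, H w> + d^2 g(F x, mu)(J w) >= |w|^2 / kappa   for all w,
   where J is the derivative of F and H the Hessian of the Lagrangian.

   Hence the augmented Lagrangian has quadratic growth for a large penalty N.  Minimizing
   it with a linear perturbation of size t gives points of gph dg at distance O(t) of
   (F x, mu), at which a regular normal (z, - J v) can be tested; letting t -> 0, then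
   N -> oo, one gets <v, H v> + <z, J v> >= |v|^2 / kappa.  It remains to pass to the
   limit along the sequences provided by the approximation assumption. *)

Require Import Defs.
From HB Require Import structures.
From mathcomp Require Import all_boot all_order all_algebra.
From mathcomp Require Import boolp classical_sets reals constructive_ereal ereal.
From mathcomp Require Import Rstruct.
From Stdlib Require RIneq Rtopology MVT.
From mathcomp Require Import ring lra zify.
Import Order.TTheory GRing.Theory Num.Theory.
Local Open Scope classical_set_scope.
Local Open Scope ring_scope.
Set Implicit Arguments.
Unset Strict Implicit.
Unset Printing Implicit Defensive.

(** * Euclidean vectors *)

(** The second-order estimate is proved at the approximating points rather than at [xb], because
    unique multipliers and regular normals are provided only there. As [g] is extended-valued and
    nonsmooth, points of gph dg are never computed: both times they arise by minimizing [g] plus a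
    quadratic over a ball whose constraint is shown to be inactive. In the penalty problem the
    residual p = s - J u - b is, up to a vanishing regularization, the difference between [mu] and
    the new multiplier. Removing the penalty is therefore the same as making the multipliers
    converge, and this is where uniqueness enters. The regularization of weight del bounds the
    minimizers and gives J^T p = del u, so that the new multiplier has almost the same image under
    J^T as [mu]. Inside these arguments most limits are replaced by one choice of small parameters;
    each step loses only an arbitrarily small term, so the constant 1/kappa survives. *)

Lemma dotvE n (u v : vec n) : dotv u v = (u^T *m v) 0 0.
Proof. by rewrite mxE; apply: eq_bigr => i _; rewrite mxE. Qed.

Lemma dotvC n (u v : vec n) : dotv u v = dotv v u.
Proof. by apply: eq_bigr => i _; rewrite mulrC. Qed.

Lemma dotvDr n (u v w : vec n) : dotv u (v + w) = dotv u v + dotv u w.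
Proof. by rewrite !dotvE mulmxDr mxE. Qed.

Lemma dotvDl n (u v w : vec n) : dotv (v + w) u = dotv v u + dotv w u.
Proof. by rewrite dotvC dotvDr !(dotvC u). Qed.

Lemma dotvZr n (u v : vec n) a : dotv u (a *: v) = a * dotv u v.
Proof. by rewrite !dotvE -scalemxAr mxE. Qed.

Lemma dotvZl n (u v : vec n) a : dotv (a *: u) v = a * dotv u v.
Proof. by rewrite dotvC dotvZr dotvC. Qed.

Lemma dotvNr n (u v : vec n) : dotv u (- v) = - dotv u v.
Proof. by rewrite -scaleN1r dotvZr mulN1r. Qed.

Lemma dotvNl n (u v : vec n) : dotv (- u) v = - dotv u v.
Proof. by rewrite dotvC dotvNr dotvC. Qed.

Lemma dotv0r n (u : vec n) : dotv u 0 = 0.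
Proof. by rewrite dotvE mulmx0 mxE. Qed.

Lemma dotv0l n (u : vec n) : dotv 0 u = 0.
Proof. by rewrite dotvC dotv0r. Qed.

Definition dotvL := (dotvDl, dotvDr, dotvNl, dotvNr, dotvZl, dotvZr).

Lemma dotv_trmx m n (A : 'M[RR]_(m, n)) (u : vec m) (v : vec n) :
  dotv (A^T *m u) v = dotv u (A *m v).
Proof. by rewrite !dotvE trmx_mul trmxK mulmxA. Qed.

Lemma dotv_sumr n (I : finType) (u : vec n) (v : I -> vec n) :
  dotv u (\sum_i v i) = \sum_i dotv u (v i).
Proof. by rewrite dotvE mulmx_sumr summxE; apply: eq_bigr => i _; rewrite dotvE. Qed.

Lemma dotvv_ge0 n (u : vec n) : 0 <= dotv u u.
Proof. by apply: sumr_ge0 => i _; rewrite -expr2 sqr_ge0. Qed.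

Lemma dotvv_eq0 n (u : vec n) : (dotv u u == 0) = (u == 0).
Proof.
apply/eqP/eqP => [h|->]; last by rewrite dotv0r.
apply/colP => i; rewrite mxE.
have /psumr_eq0P h' : forall i : 'I_n, true -> 0 <= u i 0 * u i 0.
  by move=> j _; rewrite -expr2 sqr_ge0.
by have := h' h i isT; move/eqP; rewrite mulf_eq0 orbb => /eqP.
Qed.

Lemma normv_ge0 n (u : vec n) : 0 <= normv u.
Proof. exact: sqrtr_ge0. Qed.
#[local] Hint Resolve normv_ge0 dotvv_ge0 : core.

Lemma normv_sqr n (u : vec n) : normv u ^+ 2 = dotv u u.
Proof. by rewrite sqr_sqrtr. Qed.

Lemma normv0 n : normv (0 : vec n) = 0.
Proof. by rewrite /normv dotv0r sqrtr0. Qed.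

Lemma normv_eq0 n (u : vec n) : (normv u == 0) = (u == 0).
Proof. by rewrite -dotvv_eq0 -normv_sqr sqrf_eq0. Qed.

Lemma normvZ n (u : vec n) a : normv (a *: u) = `|a| * normv u.
Proof.
by rewrite /normv dotvZl dotvZr mulrA -expr2 sqrtrM ?sqr_ge0 // sqrtr_sqr.
Qed.

Lemma normvN n (u : vec n) : normv (- u) = normv u.
Proof. by rewrite -scaleN1r normvZ normrN normr1 mul1r. Qed.

Lemma normvC n (u v : vec n) : normv (u - v) = normv (v - u).
Proof. by rewrite -normvN opprB. Qed.

Lemma dotv_le n (u v : vec n) : dotv u v <= normv u * normv v.
Proof.
have [->|u0] := eqVneq u 0; first by rewrite dotv0l normv0 mul0r.
have [->|v0] := eqVneq v 0; first by rewrite dotv0r normv0 mulr0.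
have a0 : 0 < normv u by rewrite lt_def normv_ge0 normv_eq0 u0.
have b0 : 0 < normv v by rewrite lt_def normv_ge0 normv_eq0 v0.
have := dotvv_ge0 (normv v *: u - normv u *: v).
rewrite !dotvL (dotvC v u) -!normv_sqr.
have ab : 0 < normv u * normv v by rewrite mulr_gt0.
set a := normv u in a0 ab *; set b := normv v in b0 ab *; set c := dotv u v => h.
rewrite -(ler_pM2l ab); nra.
Qed.

Lemma normr_dotv n (u v : vec n) : `|dotv u v| <= normv u * normv v.
Proof. by rewrite ler_norml dotv_le andbT lerNl -dotvNl -(normvN u) dotv_le. Qed.

Lemma normv_le n (u : vec n) a : 0 <= a -> (normv u <= a) = (dotv u u <= a ^+ 2).
Proof. by move=> a0; rewrite -normv_sqr ler_sqr ?nnegrE. Qed.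

Lemma ler_normvD n (u v : vec n) : normv (u + v) <= normv u + normv v.
Proof.
rewrite normv_le ?addr_ge0 // !dotvL (dotvC v u) sqrrD !normv_sqr.
have := dotv_le u v; lra.
Qed.

Lemma ler_normvB n (u v : vec n) : normv (u - v) <= normv u + normv v.
Proof. by rewrite -(normvN v) ler_normvD. Qed.

Lemma ler_distvD n (w u v : vec n) : normv (u - v) <= normv (u - w) + normv (w - v).
Proof. by rewrite -[u - v](subrKA w) ler_normvD. Qed.

Lemma ler_coord n (u : vec n) i : `|u i 0| <= normv u.
Proof.
rewrite -ler_sqr ?nnegrE // normv_sqr real_normK ?num_real // expr2 /dotv (bigD1 i) //=.
by rewrite lerDl sumr_ge0 // => j _; rewrite -expr2 sqr_ge0.
Qed.

Lemma ler_normv_sum n (u : vec n) : normv u <= \sum_i `|u i 0|.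
Proof.
have s0 : 0 <= \sum_i `|u i 0| by rewrite sumr_ge0.
rewrite normv_le // expr2 /dotv mulr_suml ler_sum // => i _.
apply: le_trans (ler_norm _) _; rewrite normrM ler_wpM2l // (bigD1 i) //=.
by rewrite lerDl sumr_ge0.
Qed.

(** A crude upper bound for the operator norm: it is invariant under transposition and locally
    bounded as soon as the entries are continuous. *)
Definition mxsum m n (A : 'M[RR]_(m, n)) : RR := \sum_i \sum_j `|A i j|.

Lemma mxsum_ge0 m n (A : 'M[RR]_(m, n)) : 0 <= mxsum A.
Proof. by apply: sumr_ge0 => i _; apply: sumr_ge0. Qed.

Lemma ler_normv_mulmx m n (A : 'M[RR]_(m, n)) (u : vec n) :
  normv (A *m u) <= mxsum A * normv u.
Proof.
apply: le_trans (ler_normv_sum _) _; rewrite mulr_suml ler_sum // => i _.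
rewrite mxE; apply: le_trans (ler_norm_sum _ _ _) _; rewrite mulr_suml ler_sum // => j _.
by rewrite normrM ler_wpM2l // ler_coord.
Qed.

Lemma ler_quad n (A : 'M[RR]_n) (u : vec n) : `|dotv u (A *m u)| <= mxsum A * dotv u u.
Proof.
apply: le_trans (normr_dotv _ _) _; rewrite -normv_sqr expr2 mulrCA.
by rewrite ler_wpM2l // ler_normv_mulmx.
Qed.

Lemma hessqE n m (HF : vec n -> 'I_m -> 'M[RR]_n) x v i :
  hessq HF x v i 0 = dotv v (HF x i *m v).
Proof. by rewrite mxE dotvE mulmxA. Qed.

Lemma dotv_hessL n m Hf0 (HF : vec n -> 'I_m -> 'M[RR]_n) x mu v :
  dotv v (hessL Hf0 HF x mu *m v) = dotv v (Hf0 x *m v) + dotv mu (hessq HF x v).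
Proof.
rewrite /hessL mulmxDl dotvDr mulmx_suml dotv_sumr; congr (_ + _).
by apply: eq_bigr => i _; rewrite hessqE -scalemxAl dotvZr.
Qed.

(** * Compactness and minimization *)

Lemma invS_gt0 k : 0 < (k.+1%:R^-1 : RR).
Proof. by rewrite invr_gt0 ltr0n. Qed.

Lemma invS_small (e : RR) : 0 < e ->
  exists N, forall k, (N <= k)%N -> k.+1%:R^-1 < e.
Proof.
move=> e0; have ei0 : 0 <= e^-1 by rewrite invr_ge0 ltW.
have [N hN] : exists N : nat, e^-1 < N%:R by exists (Num.bound e^-1); exact: archi_boundP.
exists N => k Nk; rewrite -[e]invrK ltf_pV2 ?posrE ?invr_gt0 ?ltr0n //.
by apply: lt_le_trans hN _; rewrite ler_nat ltnW.
Qed.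

Lemma cvg_rseq_sub (u : nat -> RR) l (s : nat -> nat) :
  (forall k, (k <= s k)%N) -> cvg_rseq u l -> cvg_rseq (fun k => u (s k)) l.
Proof.
by move=> hs ul e e0; have [N hN] := ul e e0; exists N => k Nk; apply/hN/(leq_trans Nk).
Qed.

(** The condition k <= s k on the selection, weaker than monotonicity, already lets limits be
    inherited and is stable under composition. *)
Lemma bw_real (u : nat -> RR) (B : RR) : (forall k, `|u k| <= B) ->
  exists s l, (forall k, (k <= s k)%N) /\ cvg_rseq (fun k => u (s k)) l.
Proof.
move=> uB.
have [l hl] := Rtopology.Bolzano_Weierstrass u _ (Rtopology.compact_P3 (- B) B)
  (fun k => let: conj a b := andP (etrans (esym (ler_norml _ _)) (uB k)) in
            conj (RleP a) (RleP b)).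
have h k : exists p, (k <= p)%N /\ `|u p - l| < k.+1%:R^-1.
  have [|p [kp Vp]] := hl (fun y => `|y - l| < k.+1%:R^-1) k.
    exists (RIneq.mkposreal _ (RltP (invS_gt0 k))) => y.
    by rewrite /Rtopology.disc /= RabsE => /RltP.
  by exists p; split=> //; apply/ssrnat.leP.
have [s hs] := choice h.
exists s, l; split=> [k|e e0]; first by case: (hs k).
have [N hN] := invS_small e0; exists N => k Nk.
exact: lt_trans (hs k).2 (hN k Nk).
Qed.

Lemma cvg_vseqP n (u : nat -> vec n) l :
  cvg_vseq u l <-> forall i, cvg_rseq (fun k => u k i 0) (l i 0).
Proof.
split=> [ul i e e0|ul e e0].
  have [N hN] := ul e e0; exists N => k Nk; apply: le_lt_trans (hN k Nk).
  by have := ler_coord (u k - l) i; rewrite !mxE.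
(* Dividing by n + 1 instead of n covers n = 0 and makes the final inequality strict. *)
have e1 : 0 < e / n.+1%:R by rewrite divr_gt0.
have [N hN] := choice (fun i => ul i _ e1).
exists (\max_i N i)%N => k Nk; apply: le_lt_trans (ler_normv_sum _) _.
apply: (@le_lt_trans _ _ (\sum_(i < n) e / n.+1%:R)).
  apply: ler_sum => i _; rewrite !mxE; apply/ltW/hN.
  by apply: leq_trans Nk; apply: leq_bigmax.
rewrite sumr_const card_ord -mulrnAr -mulr_natr -[ltRHS]mulr1 ltr_pM2l //.
by rewrite -ltr_pdivlMl ?invr_gt0 // invrK mulr1 ltr_nat.
Qed.

Lemma cvg_vseq_sub n (u : nat -> vec n) l (s : nat -> nat) :
  (forall k, (k <= s k)%N) -> cvg_vseq u l -> cvg_vseq (fun k => u (s k)) l.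
Proof.
by move=> hs ul e e0; have [N hN] := ul e e0; exists N => k Nk; apply/hN/(leq_trans Nk).
Qed.

(** Induction on the number [j] of coordinates that already converge along [s]; each step refines
    [s] for one more coordinate. *)
Lemma bw_vec n (u : nat -> vec n) (B : RR) : (forall k, normv (u k) <= B) ->
  exists s l, (forall k, (k <= s k)%N) /\ cvg_vseq (fun k => u (s k)) l.
Proof.
move=> uB.
have h j : exists s, (forall k, (k <= s k)%N) /\
    forall i : 'I_n, (i < j)%N -> exists l, cvg_rseq (fun k => u (s k) i 0) l.
  elim: j => [|j [s [hs IH]]]; first by exists id.
  have [nj|jn] := leqP n j.
    by exists s; split=> // i _; apply: IH; apply: leq_trans nj.
  have [s' [l [hs' hl]]] :=
    bw_real (fun k => le_trans (ler_coord (u (s k)) (Ordinal jn)) (uB (s k))).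
  exists (fun k => s (s' k)); split=> [k|i]; first exact: leq_trans (hs' k) (hs _).
  rewrite ltnS leq_eqVlt => /orP[/eqP ij|ij].
    by exists l; rewrite (_ : i = Ordinal jn) //; apply: val_inj.
  have [l' hl'] := IH i ij; exists l'.
  exact: (cvg_rseq_sub hs' hl').
have [s [hs hi]] := h n.
have [l hl] := choice (fun i => hi i (ltn_ord i)).
exists s, (\col_i l i); split=> //; apply/cvg_vseqP => i.
by rewrite mxE.
Qed.

(** If no minimizer exists, the infimum over the ball lies strictly below every value, hence below
    +oo, though it may still be -oo. A minimizing sequence then has a limit point [l], and a real
    number strictly between the infimum and [psi l] contradicts lower semicontinuity there. *)
Lemma lsc_min n (psi : vec n -> \bar RR) (c : vec n) (r : RR) : 0 <= r ->
  lsc_fun psi -> (forall x, (-oo < psi x)%E) ->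
  exists2 x, normv (x - c) <= r & forall y, normv (y - c) <= r -> (psi x <= psi y)%E.
Proof.
move=> r0 lsc psiN; apply: contrapT => nomin.
pose Im := [set psi y | y in [set y | normv (y - c) <= r]].
pose I := ereal_inf Im.
have Iy y : normv (y - c) <= r -> (I <= psi y)%E by move=> yr; apply: ereal_inf_lbound; exists y.
have Ilt y : normv (y - c) <= r -> (I < psi y)%E.
  move=> yr; rewrite lt_neqAle Iy // andbT; apply/eqP => Ie; apply: nomin.
  by exists y => // z zr; rewrite -Ie; apply: Iy.
have [a aI alim] : exists2 a : nat -> RR, (forall k, (I < (a k)%:E)%E) &
    forall b : RR, (I < b%:E)%E -> exists N, forall k, (N <= k)%N -> a k < b.
  have : (I < +oo)%E.
    by apply: lt_le_trans (Ilt c _) (leey _); rewrite subrr normv0.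
  case: (I) => [i _| // | _].
  - exists (fun k => i + k.+1%:R^-1) => [k|b]; first by rewrite lte_fin ltrDl invS_gt0.
    rewrite lte_fin -subr_gt0 => /invS_small[N hN]; exists N => k /hN.
    by rewrite ltrBrDl.
  - exists (fun k => - k%:R) => [k|b _]; first exact: ltNyr.
    exists (Num.bound `|b|) => k bk; rewrite ltrNl (le_lt_trans (ler_norm _)) // normrN.
    by apply: lt_le_trans (archi_boundP _) _ => //; rewrite ler_nat.
have h k : exists y, normv (y - c) <= r /\ (psi y < (a k)%:E)%E.
  by have [_ [y yr <-] yk] := ereal_inf_lt (aI k); exists y.
have [u hu] := choice h.
have uB k : normv (u k) <= r + normv c.
  by rewrite -[u k](subrK c); apply: le_trans (ler_normvD _ _) _; rewrite lerD2r (hu k).1.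
have [s [l [hs ul]]] := bw_vec uB.
have lr : normv (l - c) <= r.
  apply/ler_addgt0Pr => e e0; have [N hN] := ul e e0.
  apply: le_trans (ler_distvD (u (s N)) _ _) _; rewrite addrC lerD ?(hu _).1 //.
  by rewrite normvC ltW // hN.
have [b Ib bl] : exists2 b : RR, (I < b%:E)%E & (b%:E < psi l)%E.
  have := Ilt l lr; have : (I < +oo)%E by apply: lt_le_trans (Ilt l lr) (leey _).
  case: (I) => [i| // |] _; case: (psi l) (psiN l) => [p| |] // _.
  - by rewrite lte_fin => ip; exists ((i + p) / 2); rewrite lte_fin; lra.
  - by move=> _; exists (i + 1); rewrite ?ltry // lte_fin; lra.
  - by move=> _; exists (p - 1); rewrite ?ltNyr // lte_fin; lra.
  - by move=> _; exists 0; rewrite ?ltNyr ?ltry.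
have [d [d0 hd]] := lsc _ _ bl.
have [N1 hN1] := ul d d0; have [N2 hN2] := alim b Ib.
have := hd _ (hN1 (maxn N1 N2) (leq_maxl _ _)); rewrite ltNge => /negP; apply.
apply/ltW/(lt_trans (hu _).2); rewrite lte_fin; apply: hN2.
exact: leq_trans (leq_maxr N1 N2) (hs _).
Qed.

(** * Taylor expansions *)

Definition der1 (f : RR -> RR) (x l : RR) := forall e : RR, 0 < e ->
  exists2 d : RR, 0 < d & forall s, `|s| < d -> `|f (x + s) - f x - l * s| <= e * `|s|.

Lemma mvt01 (f f' : RR -> RR) : (forall c, 0 <= c <= 1 -> der1 f c (f' c)) ->
  exists2 c, 0 < c < 1 & f 1 - f 0 = f' c.
Proof.
move=> hf; have [c [/RleP c0 /RleP c1]|c [h [/RltP c0 /RltP c1]]] :=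
  MVT.MVT_cor2 f f' 0 1 (RltP ltr01) _.
- move=> e /RltP e0'; have e0 : 0 < e := e0'; have e2 : 0 < e / 2 by lra.
  have [|d d0 hd] := hf c _ (e / 2) e2; first by rewrite c0 c1.
  exists (RIneq.mkposreal d (RltP d0)) => s /eqP s0 /RltP sd; apply/RltP.
  rewrite !RealsE /= in s0 sd *.
  have s0' : 0 < `|s| by rewrite normr_gt0.
  rewrite -(ltr_pM2r s0') -normrM mulrBl divfK //.
  by apply: le_lt_trans (hd s sd) _; rewrite ltr_pM2r //; lra.
- by exists c; [rewrite c0 c1|move: h; rewrite !RealsE /= subr0 mulr1].
Qed.

Lemma der1_subquad f x l p q : der1 f x l ->
  der1 (fun s => f s - p * s - q * s ^+ 2) x (l - p - 2 * q * x).
Proof.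
move=> fl e e0; have e2 : 0 < e / 2 by lra.
have [d d0 hd] := fl _ e2.
have q0 : 0 < `|q| + 1 by rewrite ltr_wpDl.
exists (Num.min d (e / 2 / (`|q| + 1))) => [|s].
  by rewrite lt_min d0 /= divr_gt0.
rewrite lt_min => /andP[/hd h]; rewrite ltr_pdivlMr // => sq.
set E := (X in `|X| <= _).
have -> : E = (f (x + s) - f x - l * s) - q * s * s by rewrite /E; ring.
apply: le_trans (ler_normB _ _) _; rewrite !normrM.
have : `|q| * `|s| <= e / 2 by rewrite mulrDr in sq; have := normr_ge0 s; lra.
by move=> /(ler_wpM2r (normr_ge0 s)); lra.
Qed.

Lemma der1_line n (h : vec n -> RR) x a gr s :
  has_grad_at h (x + s *: a) gr -> der1 (fun s => h (x + s *: a)) s (dotv gr a).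
Proof.
move=> hg e e0; have a0 : 0 < normv a + 1 by rewrite ltr_wpDl.
have [|d [d0 hd]] := hg (e / (normv a + 1)); first exact: divr_gt0.
exists (d / (normv a + 1)) => [|r]; first exact: divr_gt0.
rewrite ltr_pdivlMr // => rd.
have := hd (r *: a); rewrite normvZ dotvZr scalerDl addrA [r * _]mulrC => /(_ _)/le_trans; apply.
  by apply: le_lt_trans rd; rewrite ler_wpM2l // lerDl.
rewrite mulrCA mulrC ler_wpM2r // mulrAC ler_pdivrMr // ler_pM2l // lerDl //.
Qed.

Lemma has_grad_dotv n p (G : vec n -> vec p) x A b :
  has_deriv_at G x A -> has_grad_at (fun y => dotv b (G y)) x (A^T *m b).
Proof.
move=> hG e e0; have b0 : 0 < normv b + 1 by rewrite ltr_wpDl.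
have [|d [d0 hd]] := hG (e / (normv b + 1)); first exact: divr_gt0.
exists d; split=> // u ud.
rewrite dotv_trmx -!dotvNr -!dotvDr; apply: le_trans (normr_dotv _ _) _.
apply: le_trans (ler_wpM2l _ (hd u ud)) _ => //.
rewrite mulrA ler_wpM2r // mulrCA ler_piMr ?ltW // ltr_pdivrMr // mul1r ltrDl //.
Qed.

Lemma ball_line n (xb x a : vec n) r s : 0 <= s <= 1 ->
  normv (x - xb) < r -> normv (x + a - xb) < r -> normv (x + s *: a - xb) < r.
Proof.
move=> /andP[s0 s1] h0 h1.
have -> : x + s *: a - xb = (1 - s) *: (x - xb) + s *: (x + a - xb).
  by apply/colP => i; rewrite !mxE; ring.
apply: le_lt_trans (ler_normvD _ _) _; rewrite !normvZ !ger0_norm ?subr_ge0 //.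
have [->|s0'] := eqVneq s 0; first by rewrite mul0r addr0 subr0 mul1r.
have {}s0' : 0 < s by rewrite lt_def s0'.
have := ltr_pM2l s0' (normv (x + a - xb)) r; rewrite h1 => h.
have : (1 - s) * normv (x - xb) <= (1 - s) * r by rewrite ler_wpM2l ?subr_ge0 // ltW.
by lra.
Qed.

Lemma fin_pos_lb (I : finType) (d : I -> RR) : (forall i, 0 < d i) ->
  exists2 r : RR, 0 < r & forall i, r <= d i.
Proof.
move=> d0; have s0 : 0 <= \sum_i (d i)^-1 by apply: sumr_ge0 => i _; rewrite invr_ge0 ltW.
(* This replaces a minimum, which would be undefined for an empty index type. *)
exists (1 + \sum_i (d i)^-1)^-1 => [|i]; first by rewrite invr_gt0; lra.
rewrite -[leRHS]invrK lef_pV2 ?posrE ?invr_gt0 //; last lra.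
rewrite (bigD1 i) //= addrCA lerDl addr_ge0 // sumr_ge0 // => j _.
by rewrite invr_ge0 ltW.
Qed.

Lemma mxsum_loc_bounded n p q (H : vec n -> 'M[RR]_(p, q)) x :
  (forall i j, contv (fun y => H y i j) x) ->
  exists r K : RR, 0 < r /\ forall y, normv (y - x) < r -> mxsum (H y) <= K.
Proof.
move=> Hc; have [d hd] := choice (fun ij : 'I_p * 'I_q => Hc ij.1 ij.2 1 ltr01).
have [r r0 hr] := fin_pos_lb (fun ij => (hd ij).1).
exists r, (\sum_i \sum_j (`|H x i j| + 1)); split=> // y yr.
apply: ler_sum => i _; apply: ler_sum => j _.
rewrite -lerBlDl (le_trans (lerB_dist _ _)) // ltW //.
exact: ((hd (i, j)).2 y (lt_le_trans yr (hr (i, j)))).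
Qed.

Section Taylor.
Variables (n : nat) (h : vec n -> RR) (gr : vec n -> vec n) (H : vec n -> 'M[RR]_n).
Hypothesis C2h : C2_scalar h gr H.

(** The mean value theorem is used twice, on [h] and then on its gradient. The constant is uniform
    in the base point [x], as prox-regularity around [xb] requires. *)
Lemma C2_quad_bound xb : exists r K : RR, [/\ 0 < r, 0 <= K & forall x a,
  normv (x - xb) < r -> normv (x + a - xb) < r ->
  `|h (x + a) - h x - dotv (gr x) a| <= K * dotv a a].
Proof.
have [hg [hH Hc]] := C2h.
have [r [K [r0 hK]]] := mxsum_loc_bounded (Hc xb).
exists r, K; split=> // [|x a xr xar].
  by apply: le_trans (mxsum_ge0 (H xb)) (hK _ _); rewrite subrr normv0.
have [c /andP[c0 c1]] := mvt01 (f := fun s => h (x + s *: a))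
  (fun s _ => der1_line (hg (x + s *: a))).
rewrite scale1r scale0r addr0 => ->.
have [s /andP[s0 s1]] := mvt01 (f := fun s => dotv a (gr (x + s *: (c *: a))))
  (fun s _ => der1_line (h := fun y => dotv a (gr y)) (has_grad_dotv a (hH (x + s *: (c *: a))))).
rewrite scale1r scale0r addr0 !(dotvC a) => ->.
rewrite dotv_trmx -scalemxAr dotvZr normrM (ger0_norm (ltW c0)).
have := ler_quad (H (x + s *: (c *: a))) a.
have : mxsum (H (x + s *: (c *: a))) <= K.
  apply: hK; rewrite scalerA; apply: ball_line => //.
  by apply/andP; split; [rewrite mulr_ge0 // ltW|rewrite mulr_ile1 // ltW].
set A := `|_|; set B := mxsum _ => BK AB.
have A0 : 0 <= A by exact: normr_ge0.
have : c * A <= A by rewrite ler_piMl // ltW.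
have : B * dotv a a <= K * dotv a a by rewrite ler_wpM2r.
by lra.
Qed.

(** Mean value theorem for [h] along the segment minus its quadratic model: the derivative of the
    difference is the first-order error of the gradient, which differentiability of [gr] at [x]
    controls. *)
Lemma taylor2 x (e : RR) : 0 < e -> exists2 d : RR, 0 < d & forall a, normv a < d ->
  `|h (x + a) - h x - dotv (gr x) a - dotv a (H x *m a) / 2| <= e * dotv a a.
Proof.
have [hg [hH _]] := C2h; move=> e0.
have [d [d0 hd]] := hH x e e0; exists d => // a ad.
have [c /andP[c0 c1]] := mvt01 (fun s _ => der1_subquad (dotv (gr x) a)
  (dotv a (H x *m a) / 2) (der1_line (hg (x + s *: a)))).
rewrite scale1r scale0r addr0 => E.
have -> : h (x + a) - h x - dotv (gr x) a - dotv a (H x *m a) / 2 =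
  dotv (gr (x + c *: a) - gr x - H x *m (c *: a)) a.
  rewrite -scalemxAr !dotvL (dotvC (H x *m a)) -[RHS]/(dotv (gr (x + c *: a)) a - _ - _).
  by lra.
apply: le_trans (normr_dotv _ _) _; rewrite -normv_sqr expr2 mulrA ler_wpM2r //.
have ca : normv (c *: a) <= normv a.
  by rewrite normvZ gtr0_norm // ler_piMl // ltW.
apply: le_trans (hd _ (le_lt_trans ca ad)) _; rewrite ler_wpM2l // ltW //.
Qed.

Lemma normr_dotv_mulmx (A : 'M[RR]_n) (u v : vec n) :
  `|dotv u (A *m v)| <= mxsum A * (normv u * normv v).
Proof.
apply: le_trans (normr_dotv _ _) _; rewrite mulrCA ler_wpM2l //.
exact: ler_normv_mulmx.
Qed.

(** The quadratic form at the increment and at t w differ by O(t^3), uniformly for [u] in a ball. *)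
Lemma taylor_parabola x w (R e : RR) : 0 < e ->
  exists2 t0 : RR, 0 < t0 & forall t u, 0 < t -> t < t0 -> normv u <= R ->
  `|h (x + (t *: w + (t ^+ 2 / 2) *: u)) - h x
    - dotv (gr x) (t *: w + (t ^+ 2 / 2) *: u)
    - (t ^+ 2 / 2) * dotv w (H x *m w)| <= e * (t ^+ 2 / 2).
Proof.
move=> e0; pose R' := `|R|; pose B := normv w + R' + 1; pose S := mxsum (H x) + 1.
have R0 : 0 <= R' := normr_ge0 R; have w0 := normv_ge0 w; have S0 := mxsum_ge0 (H x).
have B1 : 1 <= B by rewrite /B; lra.
have S1 : 1 <= S by rewrite /S; lra.
have B2 : 1 <= B ^+ 2 by rewrite exprn_ege1.
have SB0 : 0 < S * B ^+ 2 by apply: mulr_gt0; lra.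
have e1 : 0 < e / 4 / B ^+ 2 by rewrite !divr_gt0 //; lra.
have [d d0 hd] := taylor2 x e1.
exists (Num.min 1 (Num.min (d / B) (e / 4 / (S * B ^+ 2)))) => [|t u t0].
  rewrite !lt_min ltr01 /= !divr_gt0 //; lra.
rewrite !lt_min => /and3P[t1 td te] uR.
have {}uR : normv u <= R' by apply: le_trans uR _; exact: ler_norm.
set a := t *: w + _.
have tt : t ^+ 2 <= t by rewrite expr2 ler_piMl ?ltW.
have na : normv a <= t * B.
  apply: le_trans (ler_normvD _ _) _; rewrite !normvZ !ger0_norm ?ltW //; last nra.
  have u0 := normv_ge0 u; rewrite /B; nra.
have ad : normv a < d.
  by apply: le_lt_trans na _; rewrite -ltr_pdivlMr //; lra.
have aa : dotv a a <= t ^+ 2 * B ^+ 2.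
  by rewrite -exprMn -normv_le //; apply: mulr_ge0; lra.
have {}hd : `|h (x + a) - h x - dotv (gr x) a - dotv a (H x *m a) / 2| <= e / 4 * t ^+ 2.
  apply: le_trans (hd a ad) _; rewrite mulrAC ler_pdivrMr; last lra.
  by rewrite -[leRHS]mulrA ler_wpM2l //; lra.
have Q : `|dotv a (H x *m a) / 2 - t ^+ 2 / 2 * dotv w (H x *m w)| <= e / 4 * t ^+ 2.
  have -> : dotv a (H x *m a) / 2 - t ^+ 2 / 2 * dotv w (H x *m w) =
    t ^+ 3 / 4 * (dotv w (H x *m u) + dotv u (H x *m w) + t / 2 * dotv u (H x *m u)).
    rewrite /a mulmxDr -!scalemxAr !dotvL; by field.
  have b : `|dotv w (H x *m u) + dotv u (H x *m w) + t / 2 * dotv u (H x *m u)| <= 3 * (S * B ^+ 2).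
    have P p q : normv p <= B -> normv q <= B -> `|dotv p (H x *m q)| <= S * B ^+ 2.
      move=> pB qB; apply: le_trans (normr_dotv_mulmx _ _ _) _.
      rewrite ler_pM ?mulr_ge0 //; first by rewrite /S lerDl.
      by rewrite expr2 ler_pM.
    have wB : normv w <= B by rewrite /B; lra.
    have uB : normv u <= B by rewrite /B; lra.
    apply: le_trans (ler_normD _ _) _; rewrite [leLHS]addrC.
    have := ler_normD (dotv w (H x *m u)) (dotv u (H x *m w)).
    rewrite normrM (ger0_norm (x := t / 2)); last lra.
    have := P w u wB uB; have := P u w uB wB; have := P u u uB uB.
    have := normr_ge0 (dotv u (H x *m u)); set X := `|dotv u (H x *m u)|; nra.
  rewrite normrM ger0_norm; last by rewrite divr_ge0 // exprn_ge0 // ltW.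
  move: te; rewrite ltr_pdivlMr // => te.
  apply: le_trans (ler_wpM2l _ b) _; first by rewrite divr_ge0 // exprn_ge0 // ltW.
  have t2 : 0 <= t ^+ 2 by apply: sqr_ge0.
  have -> : t ^+ 3 = t ^+ 2 * t by rewrite exprSr.
  have := ler_wpM2l t2 (ltW te).
  have := mulr_ge0 (mulr_ge0 (ltW t0) (ltW SB0)) t2.
  lra.
set E := (X in `|X| <= _).
have -> : E = (h (x + a) - h x - dotv (gr x) a - dotv a (H x *m a) / 2) +
  (dotv a (H x *m a) / 2 - t ^+ 2 / 2 * dotv w (H x *m w)) by rewrite /E; ring.
apply: le_trans (ler_normD _ _) _; lra.
Qed.

End Taylor.

Lemma C2_vector_coord n m (F : vec n -> vec m) JF HF (i : 'I_m) : C2_vector F JF HF ->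
  C2_scalar (fun x => F x i 0) (fun x => (row i (JF x))^T) (fun x => HF x i).
Proof.
move=> [FJ [JH Hc]]; split=> [x e e0|]; last by split=> [x|x j k]; [exact: JH|exact: Hc].
have [d [d0 hd]] := FJ x e e0; exists d; split=> // u ud.
apply: le_trans (hd u ud); have := ler_coord (F (x + u) - F x - JF x *m u) i.
rewrite !mxE; congr (`|_ - _| <= _); by apply: eq_bigr => j _; rewrite !mxE.
Qed.

Lemma choice2 (T U : Type) (P Q : T -> U -> Prop) :
  (forall x, exists2 y, P x y & Q x y) -> exists f, forall x, P x (f x) /\ Q x (f x).
Proof.
move=> h; have h' x : exists y, P x y /\ Q x y by have [y Py Qy] := h x; exists y.
by have [f hf] := choice h'; exists f.
Qed.

Section TaylorVec.
Variables (n m : nat) (F : vec n -> vec m) (JF : vec n -> 'M[RR]_(m, n)).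
Variable (HF : vec n -> 'I_m -> 'M[RR]_n).
Hypothesis C2F : C2_vector F JF HF.

Lemma dotv_row (A : 'M[RR]_(m, n)) i a : dotv (row i A)^T a = (A *m a) i 0.
Proof. by rewrite mxE; apply: eq_bigr => j _; rewrite !mxE. Qed.

Lemma C2_vec_quad_bound xb : exists r K : RR, [/\ 0 < r, 0 <= K & forall x a,
  normv (x - xb) < r -> normv (x + a - xb) < r ->
  normv (F (x + a) - F x - JF x *m a) <= K * dotv a a].
Proof.
have /choice[r /choice[K hK]] : forall i : 'I_m, exists r, exists K, _ :=
  fun i => C2_quad_bound (C2_vector_coord i C2F) xb.
have [r0 r00 hr] : exists2 r0 : RR, 0 < r0 & forall i, r0 <= r i.
  by apply: fin_pos_lb => i; case: (hK i).
exists r0, (\sum_i K i); split=> // [|x a xr xar].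
  by apply: sumr_ge0 => i _; case: (hK i).
apply: le_trans (ler_normv_sum _) _; rewrite mulr_suml ler_sum // => i _.
have [_ _ /(_ x a)] := hK i; rewrite !mxE dotv_row mxE; apply.
  exact: lt_le_trans (hr i).
exact: lt_le_trans (hr i).
Qed.

Lemma taylor_parabola_vec x w (R e : RR) : 0 < e ->
  exists2 t0 : RR, 0 < t0 & forall t u, 0 < t -> t < t0 -> normv u <= R ->
  normv (F (x + (t *: w + (t ^+ 2 / 2) *: u)) - F x
    - t *: (JF x *m w) - (t ^+ 2 / 2) *: (JF x *m u + hessq HF x w)) <= e * (t ^+ 2 / 2).
Proof.
move=> e0; have e1 : 0 < e / m.+1%:R by rewrite divr_gt0.
have [t ht] := choice2 (fun i => taylor_parabola (C2_vector_coord i C2F) x w R e1).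
have [t0 t00 h0] := fin_pos_lb (fun i => (ht i).1).
exists t0 => // s u s0 st uR.
apply: le_trans (ler_normv_sum _) _.
apply: (@le_trans _ _ (\sum_(i < m) (e / m.+1%:R * (s ^+ 2 / 2)))).
  apply: ler_sum => i _; have := (ht i).2 s u s0 (lt_le_trans st (h0 i)) uR.
  rewrite dotv_row mulmxDr -!scalemxAr -hessqE !mxE; congr (`|_| <= _); by ring.
rewrite sumr_const card_ord -[_ *+ m]mulr_natr [_ * m%:R]mulrAC ler_wpM2r //.
  by rewrite divr_ge0 ?sqr_ge0.
rewrite mulrAC ler_pdivrMr ?ltr0n //; apply: (ler_wpM2l (ltW e0)); by rewrite ler_nat leqnSn.
Qed.

End TaylorVec.

(** * Growth from tilt stability *)

Section TiltGrowth.
Variables (n : nat) (phi : vec n -> RR) (D : set (vec n)) (M : vec n -> vec n).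
Variables (e kappa : RR).
Hypothesis e0 : 0 < e.
Hypothesis kappa0 : 0 < kappa.
Hypothesis MD : forall u, normv u < e -> D (M u).
Hypothesis Mmin : forall u x, normv u < e -> D x ->
  phi (M u) - dotv u (M u) <= phi x - dotv u x.
Hypothesis Mlip : forall u u', normv u < e -> normv u' < e ->
  normv (M u - M u') <= kappa * normv (u - u').

Let theta u := dotv u (M u) - phi (M u).

(** [M u'] competes with [M u] in the problem tilted by [u], which makes it a subgradient of [theta]
    at [u']. *)
Lemma theta_subgrad u u' : normv u < e -> normv u' < e ->
  theta u' - theta u <= dotv (u' - u) (M u').
Proof.
move=> ue ue'; have := Mmin ue (MD ue').
by rewrite /theta dotvDl dotvNl; lra.
Qed.

(* Telescoping the subgradient inequality over [N] equal steps from [u] to [u']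
   replaces the integral in the usual proof of the descent lemma. *)
Lemma theta_descent u u' : normv u < e -> normv u' < e ->
  theta u' - theta u <= dotv (u' - u) (M u) + kappa / 2 * dotv (u' - u) (u' - u).
Proof.
move=> ue ue'; set a := u' - u; set A := dotv a a.
have A0 : 0 <= A by exact: dotvv_ge0.
pose p N i := u + (i%:R / N.+1%:R) *: a : vec n.
have pe N i : (i <= N.+1)%N -> normv (p N i) < e.
  move=> iN; have := @ball_line n 0 u a e (i%:R / N.+1%:R); rewrite !subr0 => -> //.
    by rewrite divr_ge0 //= ler_pdivrMr ?ltr0n // mul1r ler_nat.
  by rewrite /a addrC subrK.
have step N i : (i <= N)%N -> theta (p N i.+1) - theta (p N i) <=
    N.+1%:R^-1 * dotv a (M u) + kappa * A / N.+1%:R ^+ 2 * i.+1%:R.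
  move=> iN; apply: le_trans (theta_subgrad _ _) _; [exact/pe/ltnW|exact: pe|].
  have N0 : 0 < N.+1%:R^-1 :> RR by exact: invS_gt0.
  have -> : p N i.+1 - p N i = N.+1%:R^-1 *: a.
    by rewrite /p -[i.+1%:R]natr1 mulrDl scalerDl mul1r opprD addrACA subrr add0r addrAC subrr add0r.
  rewrite dotvZl -[M (p N i.+1)](subrK (M u)) dotvDr mulrDr addrC lerD2l.
  have pu : normv (M (p N i.+1) - M u) <= kappa * (i.+1%:R / N.+1%:R * normv a).
    apply: le_trans (Mlip (pe N i.+1 iN) ue) _; rewrite ler_pM2l //.
    by rewrite /p addrAC subrr add0r normvZ ger0_norm // divr_ge0.
  have := le_trans (dotv_le a _) (ler_wpM2l (normv_ge0 a) pu).
  rewrite mulrCA [normv a * _]mulrCA -expr2 normv_sqr -/A => h.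
  have := ler_wpM2l (ltW N0) h; congr (_ <= _); rewrite -exprVn; ring.
(* The excess factor 1 + 1/(N+1) comes from 1 + ... + (N+1) = (N+1)(N+2)/2 and disappears as N
   grows. *)
have sum N : theta u' - theta u <=
    dotv a (M u) + kappa / 2 * A * (1 + N.+1%:R^-1).
  have -> : theta u' - theta u = \sum_(0 <= i < N.+1) (theta (p N i.+1) - theta (p N i)).
    rewrite telescope_sumr // /p mul0r scale0r addr0 divff ?pnatr_eq0 // scale1r.
    by rewrite /a [u + _]addrC subrK.
  apply: (@le_trans _ _ (\sum_(0 <= i < N.+1)
    (N.+1%:R^-1 * dotv a (M u) + kappa * A / N.+1%:R ^+ 2 * i.+1%:R))).
    by rewrite !big_mkord ler_sum // => i _; apply: step; rewrite -ltnS.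
  rewrite big_split /= -!mulr_sumr sumr_const_nat subn0 -[dotv _ _ *+ _]mulr_natl mulrA mulVf ?pnatr_eq0 // mul1r.
  rewrite lerD2l.
  have -> : \sum_(0 <= i < N.+1) (i.+1%:R : RR) = N.+1%:R * (N.+1%:R + 1) / 2.
    elim: (N.+1) => [|k IH]; first by rewrite big_geq // mul0r mul0r.
    by rewrite big_nat_recr //= IH -[k.+1]addn1 natrD; field.
  by rewrite le_eqVlt; apply/orP; left; apply/eqP; field; rewrite nat1r pnatr_eq0.
apply/ler_addgt0Pr => eps eps0.
have C0 : 0 <= kappa / 2 * A by rewrite mulr_ge0 // divr_ge0 // ltW.
have [N /(_ N (leqnn N)) hN] := invS_small (divr_gt0 eps0 (ltr_wpDl C0 ltr01)).
apply: le_trans (sum N) _; rewrite mulrDr mulr1 addrA lerD2l.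
move: hN; rewrite ltr_pdivlMr; last by lra.
have := invS_gt0 N; set q := _^-1 => q0; lra.
Qed.

(** Fenchel-Young for [theta] at the tilt u + (x - M u)/kappa, which maximizes the lower bound given
    by the descent lemma. The radius keeps this tilt in the ball of radius [e]. *)
Lemma tilt_growth u : normv u < e -> exists2 r : RR, 0 < r & forall x, D x ->
  normv (x - M u) < r ->
  phi (M u) + dotv u (x - M u) + (2 * kappa)^-1 * dotv (x - M u) (x - M u) <= phi x.
Proof.
move=> ue; exists (kappa * (e - normv u)) => [|x Dx xr].
  by rewrite mulr_gt0 // subr_gt0.
pose u' := u + kappa^-1 *: (x - M u).
have ue' : normv u' < e.
  apply: le_lt_trans (ler_normvD _ _) _; rewrite normvZ gtr0_norm ?invr_gt0 //.
  by rewrite addrC -ltrBrDr ltr_pdivrMl.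
have := theta_descent ue ue'; have := Mmin ue' Dx; rewrite /theta.
have -> : u' - u = kappa^-1 *: (x - M u) by rewrite /u' addrAC subrr add0r.
have [d dE] : exists d, d = x - M u by exists (x - M u).
have xE : x = M u + d by rewrite dE addrC subrK.
rewrite -!dE.
have -> : dotv u' x = dotv u' (M u) + dotv u' d by rewrite -dotvDr -xE.
have u'M : dotv u' (M u) = dotv u (M u) + kappa^-1 * dotv d (M u).
  by rewrite /u' -dE dotvDl dotvZl.
have u'd : dotv u' d = dotv u d + kappa^-1 * dotv d d.
  by rewrite /u' -dE dotvDl dotvZl.
rewrite u'M u'd !(dotvDl, dotvDr, dotvZl, dotvZr).
set A := dotv d d.
have -> : (2 * kappa)^-1 * A = kappa^-1 * A / 2 by rewrite invfM; ring.
have -> : kappa / 2 * (kappa^-1 * (kappa^-1 * A)) = kappa^-1 * A / 2 by field; rewrite ?gt_eqF.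
set B := kappa^-1 * A; lra.
Qed.

(* A proximal subgradient [xs] of [phi] at [x] that is close enough to the
   reference pair lies in the graph of the inverse of [M]. *)
Lemma tilt_inverse r x xs : 0 < r -> D x -> normv xs < e / 2 ->
  (forall x', D x' -> phi x + dotv xs (x' - x) - r / 2 * dotv (x' - x) (x' - x) <= phi x') ->
  r * normv (M xs - x) < e / 2 -> M xs = x.
Proof.
move=> r0 Dx xse prox small.
have e2 : 0 < e / 2 by rewrite divr_gt0.
have e2e u : normv (u - xs) <= e / 2 -> normv u < e.
  move=> h; rewrite -[u](subrK xs); apply: le_lt_trans (ler_normvD _ _) _; lra.
(* Fenchel gap of [x] at the tilt [u]; it vanishes exactly when [x] minimizes the tilted problem. *)
pose G u := theta u + phi x - dotv u x.
have G0 u : normv u < e -> 0 <= G u by move=> ue; have := Mmin ue Dx; rewrite /G /theta; lra.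
have Gsub u u' : normv u < e -> normv u' < e -> G u' - G u <= dotv (u' - u) (M u' - x).
  move=> ue ue'; have := theta_subgrad ue ue'.
  by rewrite /G !(dotvDl, dotvDr, dotvNl, dotvNr); lra.
have Gprox u : normv u < e ->
    G u <= dotv (u - xs) (M u - x) + r / 2 * dotv (M u - x) (M u - x).
  move=> ue; have := prox _ (MD ue).
  by rewrite /G /theta !(dotvDl, dotvDr, dotvNl, dotvNr); lra.
(* A proximal step for the gap from [xs]. At its minimizer [u] the optimality condition is u - xs =
   - r (M u - x); inserted in [Gprox], it bounds the nonnegative gap by - r/2 |M u - x|^2, so M u =
   x and u = xs. *)
pose P u := G u + dotv (u - xs) (u - xs) / (2 * r).
have P_cont u : normv u < e -> forall eps : RR, 0 < eps -> exists2 d : RR, 0 < d &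
    forall v, normv (v - u) < d -> normv v < e -> P u - eps < P v.
  move=> ue eps eps0.
  pose K := normv (M u - x) + (normv (u - xs)) / r + 1.
  have K0 : 0 < K by rewrite ltr_wpDl // addr_ge0 // divr_ge0 // ltW.
  exists (eps / K) => [|v]; first exact: divr_gt0.
  rewrite ltr_pdivlMr // => vu ve.
  have := Gsub v u ve ue; rewrite /P.
  have := dotv_le (u - v) (M u - x); rewrite normvC.
  have -> : v - xs = (u - xs) - (u - v) by rewrite opprB [RHS]addrC subrKA.
  rewrite [dotv (_ - _) (u - xs - _)](_ : _ = dotv (u - xs) (u - xs)
     - 2 * dotv (u - v) (u - xs) + dotv (u - v) (u - v)); last first.
    by rewrite !(dotvDl, dotvDr, dotvNl, dotvNr) ![dotv v _]dotvC ![dotv xs _]dotvC; ring.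
  have := dotv_le (u - v) (u - xs); rewrite (normvC u v).
  have : 0 <= dotv (u - v) (u - v) / (2 * r) by rewrite divr_ge0 //; lra.
  set a := dotv _ _ / _; set N := normv (v - u); set B := normv (u - xs).
  set c := dotv (u - v) (u - xs); set C := dotv (u - xs) (u - xs) => a0 cNB h1 h2.
  have -> : (C - 2 * c + dotv (u - v) (u - v)) / (2 * r) = C / (2 * r) - c / r + a.
    by rewrite /a; field; rewrite ?gt_eqF.
  have : c / r <= N * (B / r) by rewrite mulrA ler_pM2r ?invr_gt0.
  have N0 : 0 <= N := normv_ge0 _.
  move: vu; rewrite -/N /K !mulrDr mulr1 -/B; lra.
have [u ur umin] : exists2 u, normv (u - xs) <= e / 2 &
    forall v, normv (v - xs) <= e / 2 -> P u <= P v.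
  have Plsc : lsc_fun (fun u => if normv (u - xs) <= e / 2 then (P u)%:E else +oo%E).
    move=> u t; case: ifPn => [ur|/negbTE].
      rewrite lte_fin -subr_gt0 => tP; have [d d0 hd] := P_cont u (e2e _ ur) _ tP.
      exists d; split=> // z zd; case: ifPn => [zr|_]; last exact: ltry.
      by rewrite lte_fin; have := hd z zd (e2e _ zr); lra.
    move/negbT; rewrite -ltNge -subr_gt0 => ur _.
    exists (normv (u - xs) - e / 2); split=> // z zd.
    rewrite ifF ?ltry //; apply/negbTE; rewrite -ltNge.
    by have := ler_distvD z u xs; rewrite (normvC u z); lra.
  have [|u ur umin] := lsc_min xs (ltW e2) Plsc.
    by move=> u; case: ifP => _; [exact: ltNyr|].
  exists u => // v vr; have := umin v vr; rewrite ur vr lee_fin //.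
have ue := e2e _ ur.
have r2 : 0 < (2 * r)^-1 by rewrite invr_gt0; lra.
(* Comparing [P u] with [P xs] gives |u - xs| <= r |M xs - x|, so the minimizer is interior. *)
have u_int : normv (u - xs) < e / 2.
  have := umin xs; rewrite subrr normv0 => /(_ (ltW e2)).
  rewrite /P subrr dotv0l mul0r addr0 => h.
  have xse' : normv xs < e by lra.
  have := Gprox xs xse'; rewrite subrr dotv0l add0r -normv_sqr => Gxs.
  have := G0 u ue; move: h; rewrite -normv_sqr => h h0.
  have : normv (u - xs) ^+ 2 / (2 * r) <= r / 2 * normv (M xs - x) ^+ 2 by lra.
  rewrite ler_pdivrMr; last by lra.
  have -> : r / 2 * normv (M xs - x) ^+ 2 * (2 * r) = (r * normv (M xs - x)) ^+ 2.
    by field.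
  rewrite ler_sqr ?nnegrE //; last by rewrite mulr_ge0 // ltW.
  by move=> h1; exact: le_lt_trans h1 small.
(* First-order condition in direction [p]: the Lipschitz bound on [M] makes replacing [M v] by [M u]
   cost only O(s^2) in the unscaled inequality. *)
have foc p : 0 <= dotv (M u - x + r^-1 *: (u - xs)) p.
  apply/ler_addgt0Pr => eps eps0.
  pose K := kappa * dotv p p + dotv p p / (2 * r) + 1.
  have K0 : 0 < K.
    have k0 : 0 <= kappa * dotv p p by rewrite mulr_ge0 // ltW.
    have r0' : 0 <= dotv p p / (2 * r) by rewrite mulr_ge0 // ltW.
    by rewrite /K; lra.
  have p0 : 0 < normv p + 1 by rewrite ltr_wpDl.
  pose s := Num.min ((e / 2 - normv (u - xs)) / (normv p + 1)) (eps / K).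
  have s0 : 0 < s by rewrite lt_min !divr_gt0 // subr_gt0.
  have s1 : s * (normv p + 1) <= e / 2 - normv (u - xs).
    by rewrite -ler_pdivlMr // ge_min lexx.
  have s2 : s * K <= eps by rewrite -ler_pdivlMr // ge_min lexx orbT.
  pose v := u + s *: p.
  have vr : normv (v - xs) <= e / 2.
    rewrite /v addrAC; apply: le_trans (ler_normvD _ _) _.
    by rewrite normvZ gtr0_norm //; lra.
  have ve := e2e _ vr.
  have := umin v vr; have := Gsub u v ue ve.
  have -> : v - u = s *: p by rewrite /v addrAC subrr add0r.
  rewrite /P (_ : v - xs = (u - xs) + s *: p); last by rewrite /v addrAC.
  have [z zE] : exists z, z = u - xs by exists (u - xs).
  have [y yE] : exists y, y = M v - x by exists (M v - x).
  rewrite -!zE -!yE dotvZl => h1 h2.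
  have {h1 h2} : 0 <= s * dotv p y + (2 * (s * dotv z p) + s * (s * dotv p p)) / (2 * r).
    move: h1 h2; rewrite !dotvL (dotvC p z).
    set b := dotv z z.
    have -> : (b + s * dotv z p + (s * dotv z p + s * (s * dotv p p))) / (2 * r) =
       b / (2 * r) + (2 * (s * dotv z p) + s * (s * dotv p p)) / (2 * r).
      by field; rewrite ?gt_eqF.
    lra.
  rewrite yE.
  have -> : s * dotv p (M v - x) + (2 * (s * dotv z p) + s * (s * dotv p p)) / (2 * r)
    = s * (dotv p (M v - x) + dotv z p / r + s * dotv p p / (2 * r)) by field; rewrite ?gt_eqF.
  rewrite pmulr_rge0 // => h.
  have Mv : dotv p (M v - x) <= dotv p (M u - x) + kappa * s * dotv p p.
    have -> : M v - x = (M u - x) + (M v - M u) by rewrite [RHS]addrC subrKA.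
    rewrite dotvDr lerD2l; apply: le_trans (dotv_le _ _) _.
    have := Mlip ve ue; rewrite /v addrAC subrr add0r normvZ gtr0_norm // => hl.
    have := ler_wpM2l (normv_ge0 p) hl; rewrite -normv_sqr; congr (_ <= _); ring.
  move: s2; rewrite dotvDl dotvZl (dotvC _ p) /K !mulrDr mulr1.
  have -> : r^-1 * dotv z p = dotv z p / r by rewrite mulrC.
  move: h; rewrite -!mulrA; set c := dotv p p; set q := s * (c * _).
  move: Mv; have -> : kappa * s * c = s * (kappa * c) by ring.
  lra.
have uxs : u - xs = - r *: (M u - x).
  have : M u - x + r^-1 *: (u - xs) = 0.
    apply/eqP; rewrite -dotvv_eq0 eq_le dotvv_ge0 andbT -oppr_ge0 -dotvNr; exact: foc.
  move/eqP; rewrite addrC addr_eq0 => /eqP h.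
  have := congr1 (fun z => r *: z) h.
  by rewrite scalerA mulfV ?gt_eqF // scale1r scalerN -scaleNr.
have Mux : M u - x = 0.
  have := Gprox u ue; have := G0 u ue; rewrite uxs dotvZl => g0 g1.
  apply/eqP; rewrite -dotvv_eq0 eq_le dotvv_ge0 andbT.
  have : r / 2 * dotv (M u - x) (M u - x) <= 0 by lra.
  by rewrite pmulr_rle0 // divr_gt0.
move: uxs; rewrite Mux scaler0 => /eqP; rewrite subr_eq0 => /eqP <-.
by apply/eqP; rewrite -subr_eq0 Mux.
Qed.

End TiltGrowth.

(** * Limits, convex functions and penalized minimization *)

Lemma cvgr_cst (a : RR) : cvg_rseq (fun=> a) a.
Proof. by move=> e e0; exists 0%N => k _; rewrite subrr normr0. Qed.

Lemma cvgr_add u v a b : cvg_rseq u a -> cvg_rseq v b ->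
  cvg_rseq (fun k => u k + v k) (a + b).
Proof.
move=> ua vb e e0; have e2 : 0 < e / 2 by lra.
have [N hN] := ua _ e2; have [N' hN'] := vb _ e2.
exists (maxn N N') => k; rewrite geq_max => /andP[/hN h1 /hN' h2].
rewrite opprD addrACA; apply: le_lt_trans (ler_normD _ _) _; lra.
Qed.

Lemma cvgr_mul u v a b : cvg_rseq u a -> cvg_rseq v b ->
  cvg_rseq (fun k => u k * v k) (a * b).
Proof.
move=> ua vb e e0; pose K := `|a| + `|b| + 1.
have a0 := normr_ge0 a; have b0 := normr_ge0 b.
have K0 : 0 < K by rewrite /K; lra.
pose d := Num.min 1 (e / (2 * K)).
have d0 : 0 < d by rewrite lt_min ltr01 divr_gt0 //; lra.
have d1 : d <= 1 by rewrite ge_min lexx.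
have dK : d * (2 * K) <= e by rewrite -ler_pdivlMr ?ge_min ?lexx ?orbT //; lra.
have [N hN] := ua _ d0; have [N' hN'] := vb _ d0.
exists (maxn N N') => k; rewrite geq_max => /andP[/hN h1 /hN' h2].
have -> : u k * v k - a * b = (u k - a) * (v k - b) + (u k - a) * b + a * (v k - b) by ring.
have n1 := normr_ge0 (u k - a); have n2 := normr_ge0 (v k - b).
apply: le_lt_trans (ler_normD _ _) _; rewrite !normrM.
have := ler_normD ((u k - a) * (v k - b)) ((u k - a) * b); rewrite !normrM.
have p1 : `|u k - a| * `|v k - b| <= d * 1 by rewrite ler_pM // ltW // (lt_le_trans h2).
have p2 : `|u k - a| * `|b| <= d * `|b| by rewrite ler_wpM2r // ltW.
have p3 : `|a| * `|v k - b| <= `|a| * d by rewrite ler_wpM2l // ltW.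
have : d * K + d * K <= e by lra.
have : 0 < d * K by rewrite mulr_gt0.
rewrite [X in _ < X -> _](_ : _ = `|a| * d + d * `|b| + d * 1); last by rewrite /K; ring.
by rewrite [d * K](_ : _ = `|a| * d + d * `|b| + d * 1); [lra|rewrite /K; ring].
Qed.

Lemma cvgr_opp u a : cvg_rseq u a -> cvg_rseq (fun k => - u k) (- a).
Proof.
move=> ua e e0; have [N hN] := ua e e0; exists N => k /hN.
by rewrite -opprD normrN.
Qed.

Lemma cvgr_sum (I : finType) (u : I -> nat -> RR) (a : I -> RR) :
  (forall i, cvg_rseq (u i) (a i)) -> cvg_rseq (fun k => \sum_i u i k) (\sum_i a i).
Proof.
move=> ua e e0; elim: (index_enum I) e e0 => [|i s IH] e e0.
  by exists 0%N => k _; rewrite !big_nil subrr normr0.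
have := cvgr_add (ua i) (fun e e0 => IH e e0) e0.
by move=> [N hN]; exists N => k /hN; rewrite !big_cons.
Qed.

Lemma cvgr_le u a v b : cvg_rseq u a -> cvg_rseq v b ->
  (exists N, forall k, (N <= k)%N -> u k <= v k) -> a <= b.
Proof.
move=> ua vb [N0 h0]; apply/ler_addgt0Pr => e e0; have e2 : 0 < e / 2 by lra.
have [N hN] := ua _ e2; have [N' hN'] := vb _ e2; pose k := maxn N0 (maxn N N').
have k0 : (N0 <= k)%N by rewrite leq_maxl.
have k1 : (N <= k)%N by rewrite /k maxnCA leq_maxl.
have k2 : (N' <= k)%N by rewrite /k maxnA leq_maxr.
have := h0 k k0; have := hN k k1; have := hN' k k2.
by rewrite !ltr_norml => /andP[? ?] /andP[? ?] ?; lra.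
Qed.

Lemma cvgv_cst n (x : vec n) : cvg_vseq (fun=> x) x.
Proof. by move=> e e0; exists 0%N => k _; rewrite subrr normv0. Qed.

Lemma cvgv_add n (u v : nat -> vec n) a b : cvg_vseq u a -> cvg_vseq v b ->
  cvg_vseq (fun k => u k + v k) (a + b).
Proof.
move=> /cvg_vseqP ua /cvg_vseqP vb; apply/cvg_vseqP => i; rewrite mxE.
have := cvgr_add (ua i) (vb i) => h e e0; have [N hN] := h e e0.
by exists N => k /hN; rewrite mxE.
Qed.

Lemma cvgv_scale n (u : nat -> RR) (v : nat -> vec n) a b : cvg_rseq u a ->
  cvg_vseq v b -> cvg_vseq (fun k => u k *: v k) (a *: b).
Proof.
move=> ua /cvg_vseqP vb; apply/cvg_vseqP => i; rewrite mxE.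
have := cvgr_mul ua (vb i) => h e e0; have [N hN] := h e e0.
by exists N => k /hN; rewrite mxE.
Qed.

Lemma cvgv_opp n (v : nat -> vec n) b : cvg_vseq v b -> cvg_vseq (fun k => - v k) (- b).
Proof.
move=> vb e e0; have [N hN] := vb e e0; exists N => k /hN.
by rewrite -opprD normvN.
Qed.

Lemma cvgv_sub n (u v : nat -> vec n) a b : cvg_vseq u a -> cvg_vseq v b ->
  cvg_vseq (fun k => u k - v k) (a - b).
Proof. by move=> ua vb; exact: cvgv_add ua (cvgv_opp vb). Qed.

Lemma cvgm_cst m n (A : 'M[RR]_(m, n)) : cvg_mseq (fun=> A) A.
Proof. by move=> i j; exact: cvgr_cst. Qed.

Lemma cvgv_mulmx m n (A : nat -> 'M[RR]_(m, n)) (v : nat -> vec n) a b :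
  cvg_mseq A a -> cvg_vseq v b -> cvg_vseq (fun k => A k *m v k) (a *m b).
Proof.
move=> Aa /cvg_vseqP vb; apply/cvg_vseqP => i; rewrite mxE.
have h := cvgr_sum (fun j => cvgr_mul (Aa i j) (vb j)).
by move=> e e0; have [N hN] := h e e0; exists N => k /hN; rewrite mxE.
Qed.

Lemma cvgr_dotv n (u v : nat -> vec n) a b : cvg_vseq u a -> cvg_vseq v b ->
  cvg_rseq (fun k => dotv (u k) (v k)) (dotv a b).
Proof.
by move=> /cvg_vseqP ua /cvg_vseqP vb; exact: (cvgr_sum (fun i => cvgr_mul (ua i) (vb i))).
Qed.

Lemma cvgv_usubmx p q (u : nat -> vec (p + q)) a : cvg_vseq u a ->
  cvg_vseq (fun k => usubmx (u k)) (usubmx a).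
Proof.
move=> /cvg_vseqP ua; apply/cvg_vseqP => i; rewrite mxE.
by move=> e e0; have [N hN] := ua (lshift q i) e e0; exists N => k /hN; rewrite mxE.
Qed.

Lemma cvgv_dsubmx p q (u : nat -> vec (p + q)) a : cvg_vseq u a ->
  cvg_vseq (fun k => dsubmx (u k)) (dsubmx a).
Proof.
move=> /cvg_vseqP ua; apply/cvg_vseqP => i; rewrite mxE.
by move=> e e0; have [N hN] := ua (rshift p i) e e0; exists N => k /hN; rewrite mxE.
Qed.

Lemma dotv_col_mx p q (a c : vec p) (b d : vec q) :
  dotv (col_mx a b) (col_mx c d) = dotv a c + dotv b d.
Proof. by rewrite !dotvE tr_col_mx mul_row_col mxE. Qed.

Lemma lsc_fun_seq n (psi : vec n -> \bar RR) :
  (forall u x (r : RR), cvg_vseq u x -> (r%:E < psi x)%E ->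
    exists k, (r%:E < psi (u k))%E) -> lsc_fun psi.
Proof.
move=> h x r rx; apply: contrapT => hn.
have [u hu] : exists u : nat -> vec n, forall k,
    normv (u k - x) < k.+1%:R^-1 /\ ~ (r%:E < psi (u k))%E.
  have h' k : exists y, normv (y - x) < k.+1%:R^-1 /\ ~ (r%:E < psi y)%E.
    apply: contrapT => hk; apply: hn; exists k.+1%:R^-1; split; first exact: invS_gt0.
    by move=> z zk; apply: contrapT => rz; apply: hk; exists z.
  by have [f hf] := choice h'; exists f.
have ux : cvg_vseq u x.
  move=> e /invS_small[N hN]; exists N => k /hN; apply: lt_trans; exact: (hu k).1.
by have [k rk] := h u x r ux rx; apply: (hu k).2.
Qed.

Section ConvexFun.
Variables (m : nat) (g : vec m -> \bar RR).
Hypothesis g_proper : proper_fun g.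
Let gr y := fine (g y).

Lemma dom_EFin y : domg g y -> g y = (gr y)%:E.
Proof.
move=> yd; rewrite /gr fineK // fin_numE gt_eqF ?lt_eqF //; exact: g_proper.1.
Qed.

Lemma ndom_pinfty y : ~ domg g y -> g y = +oo%E.
Proof. by move/negP; rewrite -leNgt leye_eq => /eqP. Qed.

Lemma subdiffP y mu : subdiff g y mu <->
  domg g y /\ forall z, domg g z -> gr y + dotv mu (z - y) <= gr z.
Proof.
split=> [[yf h]|[yd h]].
  have yd : domg g y by rewrite /domg /= ltey_eq yf.
  by split=> // z zd; have := h z; rewrite (dom_EFin yd) (dom_EFin zd) -EFinD lee_fin.
split=> [|z]; first by rewrite (dom_EFin yd).
have [zd|/ndom_pinfty ->] := EM (domg g z); last exact: leey.
by rewrite (dom_EFin yd) (dom_EFin zd) -EFinD lee_fin h.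
Qed.

Lemma subdiff_dom y mu : subdiff g y mu -> domg g y.
Proof. by move=> /subdiffP[]. Qed.

Lemma subdiff_closed (yk muk : nat -> vec m) y mu : lsc_fun g ->
  cvg_vseq yk y -> cvg_vseq muk mu -> (forall k, subdiff g (yk k) (muk k)) ->
  subdiff g y mu.
Proof.
move=> lsc ycv mucv sub.
have lim z : cvg_rseq (fun k => dotv (muk k) (z - yk k)) (dotv mu (z - y)).
  by apply: cvgr_dotv => //; apply: cvgv_sub => //; exact: cvgv_cst.
(* Passing to the limit with a real [r] below [g y], instead of [g y] itself, serves both to show
   that [g y] is finite and to get the subgradient inequality. *)
have le_of z (r : RR) : domg g z -> (r%:E < g y)%E -> r + dotv mu (z - y) <= gr z.
  move=> zd ry; have [d [d0 hd]] := lsc _ _ ry; have [N hN] := ycv d d0.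
  apply: (cvgr_le (cvgr_add (cvgr_cst r) (lim z)) (cvgr_cst (gr z))).
  exists N => k /hN/hd rk; have /subdiffP[kd /(_ z zd)] := sub k.
  by move: rk; rewrite (dom_EFin kd) lte_fin; lra.
have yd : domg g y.
  apply: contrapT => /ndom_pinfty yoo; have [z zd] := g_proper.2.
  have := le_of z (gr z - dotv mu (z - y) + 1) zd; rewrite yoo ltry => /(_ isT); lra.
apply/subdiffP; split=> // z zd; apply/ler_addgt0Pr => e e0.
have := le_of z (gr y - e) zd; rewrite (dom_EFin yd) lte_fin; lra.
Qed.

Lemma convex_dom y z (s : RR) : convex_fun g -> 0 <= s <= 1 -> domg g y -> domg g z ->
  domg g (y + s *: (z - y)) /\ gr (y + s *: (z - y)) <= gr y + s * (gr z - gr y).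
Proof.
move=> cvx s01 yd zd; have := cvx z y s s01 zd yd.
have -> : s *: z + (1 - s) *: y = y + s *: (z - y).
  by rewrite scalerBl scale1r scalerBr addrCA.
rewrite (dom_EFin yd) (dom_EFin zd) -!EFinM -EFinD => h.
have d : domg g (y + s *: (z - y)) by apply: le_lt_trans h (ltry _).
by split=> //; move: h; rewrite (dom_EFin d) lee_fin; lra.
Qed.

(** Convexity bounds [g] on the segment to [z] by its chord; dividing by [th] and letting it tend to
    0 removes the quadratic term. *)
Lemma convex_fermat y gam : convex_fun g -> domg g y ->
  (forall z, domg g z -> exists c th0 : RR, 0 < th0 /\ forall th, 0 < th < th0 ->
     domg g (y + th *: (z - y)) ->
     gr y <= gr (y + th *: (z - y)) + th * dotv gam (z - y) + th ^+ 2 * c) ->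
  subdiff g y (- gam).
Proof.
move=> cvx yd h; apply/subdiffP; split=> // z zd; rewrite dotvNl.
have [c [th0 [th00 hc]]] := h z zd.
apply/ler_addgt0Pr => e e0; have c0 : 0 < `|c| + 1 by rewrite ltr_wpDl.
pose th := Num.min (th0 / 2) (Num.min 1 (e / (`|c| + 1))).
have t0 : 0 < th by rewrite !lt_min ltr01 !divr_gt0.
have t1 : th <= 1 by rewrite !ge_min lexx orbT.
have t2 : th < th0 by rewrite gt_min; apply/orP; left; lra.
have t3 : th * (`|c| + 1) <= e by rewrite -ler_pdivlMr // !ge_min lexx !orbT.
have [|d le] := @convex_dom y z th cvx _ yd zd; first by rewrite (ltW t0).
have := hc th; rewrite t0 t2 => /(_ isT d) le2.
have : 0 <= th * (gr z - gr y + dotv gam (z - y) + th * c).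
  by rewrite mulrDr mulrA -expr2; lra.
rewrite pmulr_rge0 // => le3.
have : th * c <= th * `|c| by rewrite ler_pM2l // ler_norm.
lra.
Qed.

End ConvexFun.

(** * Stationarity at a joint minimizer of [g] plus a quadratic *)

Section JointMin.
Variables (n m : nat) (g : vec m -> \bar RR).
Hypotheses (g_proper : proper_fun g) (g_lsc : lsc_fun g) (g_cvx : convex_fun g).
Let gr y := fine (g y).
Variables (a : vec m) (tau : RR).
Hypothesis tau0 : 0 < tau.
Variables (Q : vec n -> vec m -> RR) (gw : vec n -> vec m -> vec n) (gy : vec n -> vec m -> vec m).
Hypothesis Qcont : forall wk yk w y, cvg_vseq wk w -> cvg_vseq yk y ->
  cvg_rseq (fun k => Q (wk k) (yk k)) (Q w y).
Hypothesis Qw : forall w y p, exists c, forall th,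
  Q (w + th *: p) y = Q w y + th * dotv (gw w y) p + th ^+ 2 * c.
Hypothesis Qy : forall w y p, exists c, forall th,
  Q w (y + th *: p) = Q w y + th * dotv (gy w y) p + th ^+ 2 * c.
Let P w y := gr (a + tau *: y) + Q w y.
Variables (c1 : vec n) (c2 : vec m) (r : RR).
Hypothesis r0 : 0 < r.
Let sqd w y := dotv (w - c1) (w - c1) + dotv (y - c2) (y - c2).
Hypothesis c2_dom : domg g (a + tau *: c2).
Hypothesis interior : forall w y, domg g (a + tau *: y) -> sqd w y <= r ^+ 2 ->
  P w y <= P c1 c2 -> sqd w y < r ^+ 2.

Lemma joint_min : exists w y, [/\ domg g (a + tau *: y), sqd w y <= r ^+ 2 &
  forall w' y', domg g (a + tau *: y') -> sqd w' y' <= r ^+ 2 -> P w y <= P w' y'].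
Proof.
pose psi (q : vec (n + m)) :=
  (g (a + tau *: dsubmx q)%R + (Q (usubmx q) (dsubmx q))%:E)%E.
have ball w y : (normv (col_mx w y - col_mx c1 c2) <= r) = (sqd w y <= r ^+ 2).
  by rewrite (normv_le _ (ltW r0)) opp_col_mx add_col_mx dotv_col_mx.
have psiE w y : domg g (a + tau *: y) -> psi (col_mx w y) = (P w y)%:E.
  by move=> yd; rewrite /psi col_mxKu col_mxKd (dom_EFin g_proper yd) -EFinD.
have psi_lsc : lsc_fun psi.
  apply: lsc_fun_seq => u x t ux.
  have du := cvgv_dsubmx ux.
  have Qc := Qcont (cvgv_usubmx ux) du.
  have yc : cvg_vseq (fun k => a + tau *: dsubmx (u k)) (a + tau *: dsubmx x).
    by apply: cvgv_add; [exact: cvgv_cst|apply: cvgv_scale => //; exact: cvgr_cst].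
  move=> tx.
  have [s [s1 s2]] : exists s : RR, (s%:E < g (a + tau *: dsubmx x))%E /\
      t < s + Q (usubmx x) (dsubmx x).
    move: tx; rewrite /psi; case: (g _) (g_proper.1 (a + tau *: dsubmx x)) => [v| |] // _.
      rewrite -EFinD lte_fin => tx.
      exists (v - (v + Q (usubmx x) (dsubmx x) - t) / 2); rewrite lte_fin; split; lra.
    by move=> _; exists (t - Q (usubmx x) (dsubmx x) + 1); rewrite ltry; split=> //; lra.
  have [d [d0 hd]] := g_lsc s1; have [N1 h1] := yc d d0.
  have [|N2 h2] := Qc (s + Q (usubmx x) (dsubmx x) - t); first by lra.
  exists (maxn N1 N2); have := hd _ (h1 _ (leq_maxl N1 N2)).
  have := h2 _ (leq_maxr N1 N2); rewrite ltr_norml => /andP[h _].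
  rewrite /psi; case: (g _) => [v| |]; [|by rewrite addye // !ltry|by []].
  by rewrite -EFinD !lte_fin; lra.
have psiN q : (-oo < psi q)%E.
  rewrite /psi; have := g_proper.1 (a + tau *: dsubmx q).
  by case: (g _) => [v _| _|//]; rewrite ?addye // -EFinD ltNyr.
have [q qr qmin] := lsc_min (col_mx c1 c2) (ltW r0) psi_lsc psiN.
have qd : domg g (a + tau *: dsubmx q).
  have := qmin (col_mx c1 c2); rewrite subrr normv0 => /(_ (ltW r0)).
  rewrite psiE // /psi /domg /=; case: (g _) => [v| |] //; by rewrite ltry.
move: qr qmin; rewrite -[q]vsubmxK ball => qr qmin.
exists (usubmx q), (dsubmx q); split=> // w' y' d' r'.
by have := qmin (col_mx w' y'); rewrite ball => /(_ r'); rewrite !psiE // lee_fin.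
Qed.

(** By [interior] the ball constraint is inactive, so moving one variable at a time gives a
    vanishing gradient in [w] and a subgradient of [g] from [y]. It is used with tau = 1 for the
    augmented Lagrangian and with tau = t^2/2 for the penalty problem. *)
Lemma joint_opt : exists w y, [/\ domg g (a + tau *: y), P w y <= P c1 c2,
  sqd w y <= r ^+ 2, gw w y = 0 & subdiff g (a + tau *: y) (- (tau^-1 *: gy w y))].
Proof.
have [w [y [yd yr ymin]]] := joint_min.
have c_le : P w y <= P c1 c2.
  by apply: ymin => //; rewrite /sqd !subrr !dotv0l addr0 sqr_ge0.
have yint := interior yd yr c_le.
have room (p : vec n) (p' : vec m) : exists2 th0 : RR, 0 < th0 & forall th, 0 < th < th0 ->
    sqd (w + th *: p) (y + th *: p') <= r ^+ 2.
  pose B := 2 * (dotv (w - c1) p + dotv (y - c2) p'); pose C := dotv p p + dotv p' p'.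
  have C0 : 0 <= C by rewrite addr_ge0.
  have B0 := normr_ge0 B.
  have K0 : 0 < `|B| + C + 1 by lra.
  exists (Num.min 1 ((r ^+ 2 - sqd w y) / (`|B| + C + 1))) => [|th].
    by rewrite lt_min ltr01 divr_gt0 // subr_gt0.
  rewrite lt_min ltr_pdivlMr // => /and3P[t0 t1 t2].
  have -> : sqd (w + th *: p) (y + th *: p') = sqd w y + th * B + th * (th * C).
    rewrite /sqd /B /C ![_ + th *: _ - _]addrAC.
    have [wc ->] : exists wc, w - c1 = wc by exists (w - c1).
    have [yc ->] : exists yc, y - c2 = yc by exists (y - c2).
    by rewrite !dotvL (dotvC p wc) (dotvC p' yc); ring.
  have : th * B <= th * `|B| by rewrite ler_pM2l // ler_norm.
  have : th * (th * C) <= th * C by rewrite ler_pM2l // ler_piMl // ltW.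
  lra.
exists w, y; split=> //.
  have [c hc] := Qw w y (- gw w y); have [th0 th00 hth] := room (- gw w y) 0.
  have ge th : 0 < th < th0 -> dotv (gw w y) (gw w y) <= th * c.
    move=> th1; have := ymin (w + th *: (- gw w y)) y yd.
    have := hth th th1; rewrite scaler0 addr0 => sq /(_ sq).
    rewrite /P hc dotvNr => h; have /andP[t0 _] := th1.
    have : 0 <= th * (th * c - dotv (gw w y) (gw w y)) by rewrite mulrBr mulrA -expr2; lra.
    by rewrite pmulr_rge0 // subr_ge0.
  apply/eqP; rewrite -dotvv_eq0 eq_le dotvv_ge0 andbT.
  apply/ler_addgt0Pr => e e0; rewrite add0r; have c0 : 0 < `|c| + 1 by rewrite ltr_wpDl.
  pose th := Num.min (th0 / 2) (e / (`|c| + 1)).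
  have t0 : 0 < th by rewrite !lt_min !divr_gt0.
  have t2 : th < th0 by rewrite gt_min; apply/orP; left; lra.
  have t3 : th * (`|c| + 1) <= e by rewrite -ler_pdivlMr // !ge_min lexx !orbT.
  have := ge th; rewrite t0 t2 => /(_ isT).
  have : th * c <= th * `|c| by rewrite ler_pM2l // ler_norm.
  lra.
apply: convex_fermat => // z zd.
have zE : z = a + tau *: (tau^-1 *: (z - a)).
  by rewrite scalerA divff ?gt_eqF // scale1r addrC subrK.
have [p p_def] : exists p, p = tau^-1 *: (z - a) - y by exists (tau^-1 *: (z - a) - y).
have zp : z - (a + tau *: y) = tau *: p.
  by rewrite {1}zE p_def opprD addrACA subrr add0r -scalerBr.
have pE th : a + tau *: y + th *: (z - (a + tau *: y)) = a + tau *: (y + th *: p).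
  by rewrite zp scalerA mulrC -scalerA scalerDr addrA.
have [c hc] := Qy w y p; have [th0 th00 hth] := room 0 p.
exists c, th0; split=> // th th1; rewrite pE => d.
have := ymin w (y + th *: p) d.
have := hth th th1; rewrite scaler0 addr0 => sq /(_ sq).
rewrite /P hc /gr => h.
have -> : dotv (tau^-1 *: gy w y) (z - (a + tau *: y)) = dotv (gy w y) p.
  by rewrite zp dotvZl dotvZr mulrA mulVf ?gt_eqF // mul1r.
lra.
Qed.

End JointMin.

(** * From second-order growth to regular normals *)

Lemma liminf2_le m (Q : RR -> vec m -> \bar RR) d (c : RR) :
  (forall e : RR, 0 < e -> exists t d', [/\ 0 < t < e, normv (d' - d) < e &
     (Q t d' <= (c + e)%:E)%E]) -> (liminf2 Q d <= c%:E)%E.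
Proof.
move=> h; apply: ge_ereal_sup => _ [e e0 <-]; apply/lee_addgt0Pr => eps eps0.
have [|t [d' [/andP[t0 te] de Qe]]] := h (Num.min e eps); first by rewrite lt_min e0.
apply: (@le_trans _ _ (Q t d')).
  apply: ereal_inf_lbound; exists t, d'; rewrite t0 /=.
  by move: te de; rewrite !lt_min => /andP[-> _] /andP[-> _].
by apply: le_trans Qe _; rewrite -EFinD lee_fin lerD2l ge_min lexx orbT.
Qed.

Lemma liminf2_lt m (Q : RR -> vec m -> \bar RR) d x : (liminf2 Q d < x)%E ->
  forall e : RR, 0 < e -> exists t d', [/\ 0 < t < e, normv (d' - d) < e & (Q t d' < x)%E].
Proof.
move=> lx e e0.
pose S := [set r | exists t d', 0 < t < e /\ normv (d' - d) < e /\ r = Q t d'].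
have : (ereal_inf S < x)%E.
  by apply: le_lt_trans lx; apply: ereal_sup_ubound; exists e.
by move=> /ereal_inf_lt[_ [t [d' [te [de ->]]]] Qx]; exists t, d'.
Qed.

Lemma liminf2_ge m (Q : RR -> vec m -> \bar RR) d (c : RR) :
  (forall eps : RR, 0 < eps -> exists2 e : RR, 0 < e &
     forall t d', 0 < t < e -> normv (d' - d) < e -> ((c - eps)%:E <= Q t d')%E) ->
  (c%:E <= liminf2 Q d)%E.
Proof.
move=> h; apply/lee_subgt0Pr => eps eps0; have [e e0 he] := h eps eps0.
apply: le_ereal_sup_tmp; eexists; first by exists e.
by apply: le_ereal_inf_tmp => _ [t [d' [te [de ->]]]]; exact: he.
Qed.

Section SecondOrderQuotients.
Variables (m : nat) (g : vec m -> \bar RR).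
Hypothesis g_proper : proper_fun g.
Let gr y := fine (g y).

Lemma quot_dom y z (b q c : RR) : domg g y -> 0 < q ->
  ((g z - g y - b%:E) * q%:E < c%:E)%E -> domg g z.
Proof.
move=> yd q0 h; apply: contrapT => /ndom_pinfty zoo; move: h.
by rewrite zoo (dom_EFin g_proper yd) gt0_mulye ?lte_fin // ltNge leey.
Qed.

Lemma quotE y z (b q : RR) : domg g y -> domg g z ->
  ((g z - g y - b%:E) * q%:E = ((gr z - gr y - b) * q)%:E)%E.
Proof. by move=> yd zd; rewrite (dom_EFin g_proper yd) (dom_EFin g_proper zd). Qed.

Lemma d2sub_le y mu d (c : RR) : domg g y ->
  (forall e : RR, 0 < e -> exists t d', [/\ 0 < t < e, normv (d' - d) < e,
     domg g (y + t *: d') &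
     gr (y + t *: d') - gr y - t * dotv mu d' <= (c + e) * (t ^+ 2 / 2)]) ->
  (d2sub g y mu d <= c%:E)%E.
Proof.
move=> yd h; apply: liminf2_le => e e0.
have [t [d' [te de zd hle]]] := h e e0; exists t, d'; split=> //.
rewrite quotE // lee_fin ler_pdivrMr // divr_gt0 // exprn_gt0 //.
by case/andP: te.
Qed.

End SecondOrderQuotients.

Section NormalCone.
Variables (n m : nat) (g : vec m -> \bar RR).
Hypotheses (g_proper : proper_fun g) (g_lsc : lsc_fun g) (g_cvx : convex_fun g).
Let gr y := fine (g y).
Variables (y0 mu : vec m) (J : 'M[RR]_(m, n)) (H : 'M[RR]_n) (kappa : RR).
Hypothesis sub_mu : subdiff g y0 mu.
Hypothesis growth : forall w,
  ((kappa^-1 * dotv w w)%:E <= (dotv w (H *m w))%:E + d2sub g y0 mu (J *m w))%E.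

Let Delta y := gr (y0 + y) - gr y0 - dotv mu y.

Lemma Delta_ge0 y : domg g (y0 + y) -> 0 <= Delta y.
Proof.
move=> yd; have [_ /(_ _ yd)] := (subdiffP g_proper _ _).1 sub_mu.
by rewrite addrAC subrr add0r /Delta /gr; lra.
Qed.

(** Compactness: counterexamples with N = k+1 and beta = r = 1/(k+1) are scaled to unit length and
    converge to some (w0, v0). The penalty forces v0 = J w0; the remaining terms contradict [growth]
    with the gap [eps] unless w0 = 0, which the unit length excludes. *)
Lemma augmented_growth (eps : RR) : 0 < eps -> exists N beta r : RR,
  [/\ 0 < N, 0 < beta, 0 < r & forall w y, domg g (y0 + y) ->
    dotv w w + dotv y y <= r ^+ 2 ->
    beta * (dotv w w + dotv y y) <= Delta y + dotv w (H *m w) / 2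
      - (kappa^-1 - eps) / 2 * dotv w w + N / 2 * dotv (y - J *m w) (y - J *m w)].
Proof.
move=> eps0; apply: contrapT => hn; set c := kappa^-1 - eps in hn.
have [wk [yk hk]] : exists (wk : nat -> vec n) (yk : nat -> vec m), forall k,
   [/\ domg g (y0 + yk k), dotv (wk k) (wk k) + dotv (yk k) (yk k) <= (k.+1%:R^-1) ^+ 2 &
    Delta (yk k) + dotv (wk k) (H *m wk k) / 2 - c / 2 * dotv (wk k) (wk k)
    + k.+1%:R / 2 * dotv (yk k - J *m wk k) (yk k - J *m wk k)
    < k.+1%:R^-1 * (dotv (wk k) (wk k) + dotv (yk k) (yk k))].
  have h k : exists p : vec n * vec m, [/\ domg g (y0 + p.2),
    dotv p.1 p.1 + dotv p.2 p.2 <= (k.+1%:R^-1) ^+ 2 &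
    Delta p.2 + dotv p.1 (H *m p.1) / 2 - c / 2 * dotv p.1 p.1
    + k.+1%:R / 2 * dotv (p.2 - J *m p.1) (p.2 - J *m p.1)
    < k.+1%:R^-1 * (dotv p.1 p.1 + dotv p.2 p.2)].
    apply: contrapT => hk; apply: hn; exists k.+1%:R, k.+1%:R^-1, k.+1%:R^-1.
    split; rewrite ?invS_gt0 ?ltr0n // => w y yd wy.
    by rewrite leNgt; apply/negP => lt; apply: hk; exists (w, y).
  by have [p hp] := choice h; exists (fun k => (p k).1), (fun k => (p k).2).
pose T k := dotv (wk k) (wk k) + dotv (yk k) (yk k).
have T0 k : 0 < T k.
  rewrite lt_def addr_ge0 // andbT paddr_eq0 // !dotvv_eq0; apply/negP => /andP[/eqP w0 /eqP e].
  have [_ _] := hk k; rewrite w0 e /Delta /gr !(mulmx0, dotv0l, dotv0r, subr0, addr0, mulr0, mul0r, subrr).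
  by rewrite ltxx.
pose t k := Num.sqrt (T k).
have t0 k : 0 < t k by rewrite sqrtr_gt0.
have tT k : t k ^+ 2 = T k by rewrite sqr_sqrtr // ltW.
have tk k : t k <= k.+1%:R^-1.
  by have [_ h _] := hk k; rewrite -ler_sqr ?nnegrE ?tT // ltW // invS_gt0.
pose w' k := (t k)^-1 *: wk k; pose y' k := (t k)^-1 *: yk k.
have wE k : wk k = t k *: w' k by rewrite scalerA divff ?gt_eqF // scale1r.
have yE k : yk k = t k *: y' k by rewrite scalerA divff ?gt_eqF // scale1r.
have one k : dotv (w' k) (w' k) + dotv (y' k) (y' k) = 1.
  rewrite !dotvZl !dotvZr -!mulrDr mulrA -/(T k) -tT -expr2 -exprMn mulVf ?gt_eqF //.
  by rewrite expr1n.
have w1 k : normv (w' k) <= 1.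
  by rewrite normv_le // expr1n -(one k) lerDl.
have y1 k : normv (y' k) <= 1.
  by rewrite normv_le // expr1n -(one k) lerDr.
have Q k : [/\ domg g (y0 + t k *: y' k), t k <= k.+1%:R^-1 &
    Delta (t k *: y' k) / t k ^+ 2 + dotv (w' k) (H *m w' k) / 2
    - c / 2 * dotv (w' k) (w' k)
    + k.+1%:R / 2 * dotv (y' k - J *m w' k) (y' k - J *m w' k) < k.+1%:R^-1].
  have [d _ h] := hk k; split=> //; first by rewrite -yE.
  have t2 : 0 < t k ^+ 2 by rewrite exprn_gt0.
  move: h; rewrite -/(T k) -tT -ltr_pdivrMr //; congr (_ < _).
  rewrite [in LHS]wE [in LHS]yE -!scalemxAr -!scalerBr !dotvZl !dotvZr.
  by field; rewrite gt_eqF.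
have [s1 [w0 [hs1 w0cv]]] := bw_vec w1.
have [s2 [v0 [hs2 v0cv]]] := bw_vec (fun k => y1 (s1 k)).
pose s k := s1 (s2 k).
have hs k : (k <= s k)%N by exact: leq_trans (hs2 k) (hs1 _).
have {}w0cv : cvg_vseq (fun k => w' (s k)) w0 := cvg_vseq_sub hs2 w0cv.
have {}v0cv : cvg_vseq (fun k => y' (s k)) v0 := v0cv.
have inv0 : cvg_rseq (fun k => k.+1%:R^-1) 0.
  move=> e /invS_small[N hN]; exists N => k /hN.
  by rewrite subr0 gtr0_norm ?invS_gt0.
have sinv k : (s k).+1%:R^-1 <= (k.+1%:R^-1 : RR).
  by rewrite lef_pV2 ?posrE ?ltr0n // ler_nat ltnS.
have lim1 : dotv w0 w0 + dotv v0 v0 = 1.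
  have h := cvgr_add (cvgr_dotv w0cv w0cv) (cvgr_dotv v0cv v0cv).
  by apply/eqP; rewrite eq_le (cvgr_le h (cvgr_cst 1)) ?(cvgr_le (cvgr_cst 1) h) //;
     exists 0%N => k _; rewrite one.
have Dge k : 0 <= Delta (t k *: y' k) / t k ^+ 2.
  by have [d _ _] := Q k; rewrite divr_ge0 ?sqr_ge0 // Delta_ge0.
have Hcv := cvgr_dotv w0cv (cvgv_mulmx (cvgm_cst H) w0cv).
(* After scaling, all other terms are bounded below ([Delta] is nonnegative), so the penalty term
   stays bounded while its weight tends to infinity. *)
have vJ : v0 = J *m w0.
  have dcv := cvgv_sub v0cv (cvgv_mulmx (cvgm_cst J) w0cv).
  pose K := 2 * (1 + mxsum H + `|c|).
  have S0 := mxsum_ge0 H; have c0 := normr_ge0 c.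
  have h := cvgr_mul (cvgr_cst K) inv0; rewrite mulr0 in h.
  apply/eqP; rewrite -subr_eq0 -dotvv_eq0 eq_le dotvv_ge0 andbT.
  apply: (cvgr_le (cvgr_dotv dcv dcv) h); exists 0%N => k _.
  apply: (@le_trans _ _ (K * (s k).+1%:R^-1)); last first.
    by rewrite ler_wpM2l // /K; lra.
  rewrite ler_pdivlMr ?ltr0n //.
  have [_ _] := Q (s k); have := Dge (s k); set D := Delta _ / _.
  have := ler_quad H (w' (s k)); rewrite ler_norml => /andP[+ _].
  have W1 : dotv (w' (s k)) (w' (s k)) <= 1 by rewrite -(one (s k)) lerDl.
  have := ler_wpM2l S0 W1; have := ler_wpM2l c0 W1.
  have := ler_wpM2r (dotvv_ge0 (w' (s k))) (ler_norm c).
  have i1 : (s k).+1%:R^-1 <= (1 : RR) by rewrite invf_le1 ?ltr0n // ler1n.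
  move: i1; rewrite /K; set ni := _^-1; set nn := (s k).+1%:R; set W := dotv (w' _) (w' _); set X := dotv (_ - _) _.
  by clearbody ni nn; lra.
have d2 : (d2sub g y0 mu (J *m w0) <= (- dotv w0 (H *m w0) + c * dotv w0 w0)%:E)%E.
  apply: d2sub_le => //; first exact: subdiff_dom sub_mu.
  move=> e e0; have e2 : 0 < e / 2 by lra.
  have e4 : 0 < e / 4 by lra.
  have Lcv := cvgr_add (cvgr_opp Hcv) (cvgr_mul (cvgr_cst c) (cvgr_dotv w0cv w0cv)).
  have [N1 h1] := Lcv _ e2; have [N2 h2] := v0cv e e0; have [N3 h3] := invS_small e4.
  pose k := maxn N1 (maxn N2 N3).
  have k1 : (N1 <= k)%N by rewrite leq_maxl.
  have k2 : (N2 <= k)%N by rewrite /k maxnCA leq_maxl.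
  have k3 : (N3 <= k)%N by rewrite /k maxnA leq_maxr.
  have [d _ q] := Q (s k); exists (t (s k)), (y' (s k)).
  have ie : (s k).+1%:R^-1 < e / 4 by apply: le_lt_trans (sinv k) (h3 k k3).
  have ts := tk (s k).
  split=> //; [|by rewrite -vJ h2|].
    by rewrite t0 /=; apply: le_lt_trans ts (lt_trans ie _); lra.
  have := h1 k k1; rewrite /= ltr_norml => /andP[_ +].
  have : 0 <= (s k).+1%:R / 2 * dotv (y' (s k) - J *m w' (s k)) (y' (s k) - J *m w' (s k)).
    by rewrite mulr_ge0 // divr_ge0.
  move: q ie {ts}; set nn := (s k).+1%:R; set ni := nn^-1; set X := dotv (_ - _) (_ - _).
  clearbody ni nn => q ie X0 a.
  have t2 : 0 < t (s k) ^+ 2 by rewrite exprn_gt0.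
  have : Delta (t (s k) *: y' (s k)) / t (s k) ^+ 2
     <= (- dotv w0 (H *m w0) + c * dotv w0 w0 + e) / 2.
    by lra.
  rewrite ler_pdivrMr // /Delta dotvZr /gr; lra.
have := le_trans (growth w0) (leeD (lexx _) d2).
rewrite -EFinD lee_fin => h.
have ww : dotv w0 w0 = 0.
  apply/eqP; rewrite eq_le dotvv_ge0 andbT.
  have : eps * dotv w0 w0 <= 0 by rewrite /c in h; lra.
  by rewrite pmulr_rle0.
have := lim1; move/eqP: ww; rewrite dotvv_eq0 => /eqP w00.
by rewrite vJ w00 mulmx0 !dotv0r addr0 => /eqP; rewrite eq_sym oner_eq0.
Qed.

Section Quadratic.
Variables (c N t : RR) (cc : vec n).

(* No symmetry of [H] is assumed, hence the symmetrized Hessian in the gradient [augQw]. *)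
Definition augQ (w : vec n) (y : vec m) : RR :=
  - dotv mu y + dotv w (H *m w) / 2 - c / 2 * dotv w w
  + N / 2 * dotv (y - J *m w) (y - J *m w) - t * dotv cc w.

Definition augQw w y : vec n :=
  2^-1 *: (H *m w + H^T *m w) - c *: w - N *: (J^T *m (y - J *m w)) - t *: cc.

Definition augQy w y : vec m := - mu + N *: (y - J *m w).

Lemma augQ_cont wk yk w y : cvg_vseq wk w -> cvg_vseq yk y ->
  cvg_rseq (fun k => augQ (wk k) (yk k)) (augQ w y).
Proof.
move=> hw hy; have hJ := cvgv_sub hy (cvgv_mulmx (cvgm_cst J) hw).
apply: cvgr_add; last by apply/cvgr_opp/(cvgr_mul (cvgr_cst _))/cvgr_dotv => //; exact: cvgv_cst.
apply: cvgr_add; last exact: (cvgr_mul (cvgr_cst _) (cvgr_dotv hJ hJ)).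
apply: cvgr_add; last exact: (cvgr_opp (cvgr_mul (cvgr_cst _) (cvgr_dotv hw hw))).
apply: cvgr_add; first exact: (cvgr_opp (cvgr_dotv (cvgv_cst _) hy)).
apply: cvgr_mul; last exact: cvgr_cst.
exact: (cvgr_dotv hw (cvgv_mulmx (cvgm_cst H) hw)).
Qed.

Lemma augQ_w w y p : exists d, forall th,
  augQ (w + th *: p) y = augQ w y + th * dotv (augQw w y) p + th ^+ 2 * d.
Proof.
exists (dotv p (H *m p) / 2 - c / 2 * dotv p p + N / 2 * dotv (J *m p) (J *m p)) => th.
have -> : dotv (augQw w y) p = 2^-1 * (dotv p (H *m w) + dotv w (H *m p))
    - c * dotv w p - N * dotv (y - J *m w) (J *m p) - t * dotv cc p.
  by rewrite /augQw !(dotvDl, dotvNl, dotvZl) !dotv_trmx !dotvL (dotvC (H *m w)); ring.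
rewrite /augQ !mulmxDr -!scalemxAr !dotvL ![dotv p w]dotvC ![dotv _ y]dotvC.
rewrite ![dotv (J *m p) (J *m w)]dotvC ![dotv (J *m p) y]dotvC.
by field.
Qed.

Lemma augQ_y w y p : exists d, forall th,
  augQ w (y + th *: p) = augQ w y + th * dotv (augQy w y) p + th ^+ 2 * d.
Proof.
exists (N / 2 * dotv p p) => th.
rewrite /augQ /augQy; have -> : y + th *: p - J *m w = (y - J *m w) + th *: p by rewrite addrAC.
have [q ->] : exists q, y - J *m w = q by exists (y - J *m w).
by rewrite !dotvL (dotvC p q); field.
Qed.

End Quadratic.

(** The normal inequality is tested at (y0 + y, mu - N q), q = y - J w, where (w, y) minimizes the
    augmented Lagrangian tilted by - t <cc, w>. Comparison with (0, 0) gives <cc, w> >= 0, while the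
    normal inequality gives <cc, w> <= t <v, cc> + t eta. *)
Lemma normal_cone_growth z v :
  reg_normal (gph_subdiff g) (y0, mu) (z, - (J *m v)) ->
  kappa^-1 * dotv v v <= dotv v (H *m v) + dotv z (J *m v).
Proof.
move=> [_ nrm]; apply/ler_addgt0Pr => eps' eps'0.
have v1 : 0 < dotv v v + 1 by rewrite ltr_wpDl.
pose eps := eps' / (dotv v v + 1); have eps0 : 0 < eps by rewrite divr_gt0.
suff : (kappa^-1 - eps) * dotv v v <= dotv v (H *m v) + dotv z (J *m v).
  have : eps * dotv v v <= eps'.
    by rewrite /eps mulrAC ler_pdivrMr // ler_pM2l // lerDl.
  lra.
have [N0 [beta [r [N00 beta0 r0 aug]]]] := augmented_growth eps0.
move: aug; set c := kappa^-1 - eps => aug.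
(* Chosen so that <v, cc> is the difference of the two sides of the claim, and so that stationarity
   in [w] turns the normal inequality into a bound on <cc, w>. *)
have [cc ccE] : exists cc, cc = J^T *m z + 2^-1 *: (H *m v + H^T *m v) - c *: v.
  by exists (J^T *m z + 2^-1 *: (H *m v + H^T *m v) - c *: v).
suff : 0 <= dotv v cc.
  rewrite ccE !dotvL [dotv v (J^T *m z)]dotvC !dotv_trmx.
  by rewrite [dotv v (H^T *m v)]dotvC dotv_trmx; lra.
apply/ler_addgt0Pr => eta eta0.
pose A := dotv cc cc / beta; have A0 : 0 <= A by rewrite divr_ge0 // ltW.
(* Penalty in excess of [N0]: it gives |q|^2 <= 2 A t^2 / L, and this value of L makes |z| |q| <= t
   eta / 2. *)
pose L := 8 * A * dotv z z / eta ^+ 2 + 1.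
have eta2 : 0 < eta ^+ 2 by rewrite exprn_gt0.
have L0 : 0 < L.
  apply: ltr_wpDl => //; apply: divr_ge0; last exact: ltW.
  by apply: mulr_ge0 => //; apply: mulr_ge0.
(* t B will bound the distance from the test point to (y0, mu), so the tolerance eta / 2 / (B + 1)
   costs at most t eta / 2. *)
pose N := N0 + L; pose B := Num.sqrt (A / beta + N ^+ 2 * (2 * A / L)).
have B0 : 0 <= B := sqrtr_ge0 _; have B1 : 0 < B + 1 by lra.
have [|d [d0 hd]] := nrm (eta / 2 / (B + 1)); first by rewrite !divr_gt0.
pose nc := normv cc; have nc0 : 0 <= nc := normv_ge0 _.
(* The first bound keeps the minimizer inside the ball of radius [r], the second keeps the test
   point within [d]. *)
pose t := Num.min (r * beta / (nc + 1)) (d / (B + 1)) / 2.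
have nc1 : 0 < nc + 1 by lra.
have t0 : 0 < t by rewrite divr_gt0 // lt_min !divr_gt0 // mulr_gt0.
have t1 : t * (nc + 1) < r * beta.
  rewrite -ltr_pdivlMr // /t ltr_pdivrMr // gt_min.
  by apply/orP; left; rewrite ltr_pMr ?ltr1n // divr_gt0 // mulr_gt0.
have t2 : t * (B + 1) < d.
  rewrite -ltr_pdivlMr // /t ltr_pdivrMr // gt_min.
  by apply/orP; right; rewrite ltr_pMr ?ltr1n // divr_gt0.
clearbody t; have y0d := subdiff_dom g_proper sub_mu.
pose P w y := gr (y0 + 1 *: y) + augQ c N t cc w y.
have P0 : P 0 0 = gr y0.
  by rewrite /P /augQ scaler0 addr0 !mulmx0 subr0 !(dotv0r, dotv0l); ring.
have low w y : domg g (y0 + 1 *: y) -> dotv w w + dotv y y <= r ^+ 2 -> P w y <= P 0 0 ->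
    beta * (dotv w w + dotv y y) + L / 2 * dotv (y - J *m w) (y - J *m w) <= t * dotv cc w.
  rewrite P0 /P /augQ scale1r => yd wy; have := aug w y yd wy; rewrite /Delta /N.
  by set X := dotv (y - _) _; lra.
have small w y : domg g (y0 + 1 *: y) -> dotv w w + dotv y y <= r ^+ 2 -> P w y <= P 0 0 ->
    t * dotv cc w <= t ^+ 2 * A /\ dotv w w + dotv y y <= t ^+ 2 * (A / beta).
  move=> yd wy Pwy; have l := low w y yd wy Pwy.
  have X0 : 0 <= L / 2 * dotv (y - J *m w) (y - J *m w) by rewrite mulr_ge0 // divr_ge0 // ltW.
  have cw := dotv_le cc w; rewrite -/nc in cw.
  have w0 := normv_ge0 w; have y2 := dotvv_ge0 y.
  have bw : beta * normv w <= t * nc.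
    have [->|wn] := eqVneq (normv w) 0; first by rewrite mulr0 mulr_ge0 // ltW.
    have {}w0 : 0 < normv w by rewrite lt_def wn.
    rewrite -(ler_pM2r w0); have : beta * dotv w w <= t * (nc * normv w).
      have : 0 <= beta * dotv y y by rewrite mulr_ge0 // ltW.
      by have := ler_wpM2l (ltW t0) cw; lra.
    by rewrite -normv_sqr expr2 !mulrA.
  have c1 : t * dotv cc w <= t ^+ 2 * A.
    apply: (@le_trans _ _ (t * (nc * normv w))); first by rewrite ler_pM2l.
    rewrite expr2 -mulrA ler_pM2l // /A -normv_sqr -/nc mulrA ler_pdivlMr // expr2.
    have := ler_wpM2l nc0 bw; lra.
  split=> //; rewrite mulrA ler_pdivlMr // mulrC; lra.
have [||w [y []]] := @joint_opt n m g g_proper g_lsc g_cvx y0 1 ltr01 _ _ _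
  (@augQ_cont c N t cc) (@augQ_w c N t cc) (@augQ_y c N t cc) 0 0 r r0.
- by rewrite scaler0 addr0.
- move=> w y yd; rewrite !subr0 => wy Pwy; have [_ h] := small w y yd wy Pwy.
  apply: le_lt_trans h _; have : t * nc < r * beta by lra.
  have tn : 0 <= t * nc by rewrite mulr_ge0 // ltW.
  rewrite -ltr_sqr ?nnegrE //; last by rewrite mulr_ge0 // ltW.
  rewrite /A -normv_sqr -/nc !exprMn => h1.
  have -> : t ^+ 2 * (nc ^+ 2 / beta / beta) = t ^+ 2 * nc ^+ 2 / beta ^+ 2.
    by field; rewrite ?gt_eqF.
  by rewrite ltr_pdivrMr ?exprn_gt0.
rewrite -/(P w y) -/(P 0 0) !subr0 scale1r invr1 scale1r => yd Pwy wy gw0 sub.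
have [cw1 wy1] := small w y (eq_ind_r _ yd (congr1 _ (scale1r _))) wy Pwy.
have l := low w y (eq_ind_r _ yd (congr1 _ (scale1r _))) wy Pwy.
have [q qE] : exists q, q = y - J *m w by exists (y - J *m w).
rewrite -qE in l.
have b0 : 0 <= beta * (dotv w w + dotv y y) by rewrite mulr_ge0 ?addr_ge0 // ltW.
have q0 := dotvv_ge0 q.
have Lq : 0 <= L / 2 * dotv q q by rewrite mulr_ge0 // divr_ge0 // ltW.
have cw0 : 0 <= dotv cc w by rewrite -(pmulr_rge0 _ t0); lra.
clearbody A.
have qq : dotv q q <= t ^+ 2 * (2 * A / L).
  rewrite !mulrA ler_pdivlMr //; lra.
have gph : gph_subdiff g (y0 + y, mu - N *: q).
  by move: sub; rewrite /augQy -qE opprD opprK.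
have np : normp y (- (N *: q)) <= t * B.
  have -> : t * B = Num.sqrt ((t * B) ^+ 2) by rewrite sqrtr_sqr ger0_norm // mulr_ge0 // ltW.
  rewrite /normp ler_sqrt ?sqr_ge0 //.
  rewrite exprMn sqr_sqrtr; last first.
    apply: addr_ge0; first exact: divr_ge0 A0 (ltW beta0).
    apply: mulr_ge0; first exact: sqr_ge0.
    by apply: divr_ge0; [exact: mulr_ge0|exact: ltW].
  have -> : dotv (- (N *: q)) (- (N *: q)) = N ^+ 2 * dotv q q by rewrite !dotvL; ring.
  rewrite mulrDr lerD //.
    by apply: le_trans wy1; rewrite lerDr.
  by rewrite [t ^+ 2 * _]mulrCA ler_wpM2l ?sqr_ge0.
have := hd _ gph; rewrite /= [y0 + y]addrC addrK [mu - _]addrC addrK.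
have np' : normp y (- (N *: q)) < d.
  by apply: le_lt_trans np _; have := t0; lra.
move=> /(_ np') => h.
have {h} : dotv z y + dotv (J *m v) (N *: q) <= t * (eta / 2).
  rewrite dotvNl dotvNr opprK in h; apply: le_trans h _.
  apply: le_trans (ler_wpM2l _ np) _; first by rewrite !divr_ge0 // ltW.
  have -> : eta / 2 / (B + 1) * (t * B) = t * (eta / 2) * (B / (B + 1)).
    by field; rewrite gt_eqF.
  apply: ler_piMr; first by rewrite mulr_ge0 ?divr_ge0 // ltW.
  by rewrite ler_pdivrMr // mul1r lerDl.
have -> : dotv z y = dotv (J^T *m z) w + dotv z q.
  by rewrite qE dotvDr dotvNr dotv_trmx; ring.
(* Stationarity in [w], paired with [v], trades the unknown multiplier increment for terms linear in
   [w]. *)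
have -> : dotv (J *m v) (N *: q) = dotv v (2^-1 *: (H *m w + H^T *m w) - c *: w - t *: cc).
  have : dotv v (augQw c N t cc w y) = 0 by rewrite gw0 dotv0r.
  rewrite /augQw -qE !dotvL ![dotv v (_^T *m _)]dotvC !dotv_trmx [dotv (J *m v) q]dotvC.
  lra.
have zq : - (t * (eta / 2)) <= dotv z q.
  have : `|dotv z q| <= t * (eta / 2); last by rewrite ler_norml => /andP[].
  apply: le_trans (normr_dotv _ _) _.
  rewrite -ler_sqr ?nnegrE ?mulr_ge0 ?divr_ge0 // ?(ltW t0) ?(ltW eta0) //.
  rewrite exprMn !normv_sqr; apply: le_trans (ler_wpM2l _ qq) _ => //.
  rewrite mulrCA exprMn ler_wpM2l ?sqr_ge0 // mulrA ler_pdivrMr // expr_div_n.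
  have : eta ^+ 2 * (8 * A * dotv z z / eta ^+ 2) = 8 * A * dotv z z.
    by rewrite mulrC divfK // gt_eqF.
  by rewrite /L; lra.
have -> : dotv v (2^-1 *: (H *m w + H^T *m w) - c *: w - t *: cc) =
    dotv (2^-1 *: (H *m v + H^T *m v) - c *: v) w - t * dotv v cc.
  rewrite !dotvL ![dotv v (_^T *m _)]dotvC !dotv_trmx.
  by rewrite [dotv (H *m v) w]dotvC; ring.
move=> h; have : dotv cc w <= t * dotv v cc + t * eta.
  have -> : dotv cc w = dotv (J^T *m z) w
      + dotv (2^-1 *: (H *m v + H^T *m v) - c *: v) w by rewrite ccE -addrA dotvDl.
  lra.
move=> h1; rewrite -(pmulr_rge0 _ t0); lra.
Qed.

End NormalCone.

(** * Second-order growth at points with a unique multiplier *)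

Ltac lra_goal := repeat match goal with H : is_true _ |- _ => clear H end; lra.

Lemma addr2K (V : zmodType) (a b c : V) : a + b + c - a = b + c.
Proof. by rewrite -[a + b + c]addrA addrAC subrr add0r. Qed.

(** A bounded second-order quotient forces the first-order quotients down to <mu, d> along some
    sequence; the subgradient inequality gives the reverse bound. *)
Lemma subderivE m (g : vec m -> \bar RR) y mu d (al : RR) : proper_fun g ->
  subdiff g y mu -> (d2sub g y mu d < al%:E)%E -> subderiv g y d = (dotv mu d)%:E.
Proof.
move=> gp sub lt; have yd := subdiff_dom gp sub; have nm := normv_ge0 mu.
have mu1 : 0 < normv mu + 1 by lra.
have near (e : RR) d' : normv (d' - d) < e -> `|dotv mu d' - dotv mu d| <= normv mu * e.
  move=> de; rewrite -dotvNr -dotvDr; apply: le_trans (normr_dotv _ _) _.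
  by rewrite ler_wpM2l // ltW.
have quot1 (t : RR) d' : 0 < t -> domg g (y + t *: d') ->
    ((g (y + t *: d')%R - g y) * (t^-1)%:E)%E
      = ((fine (g (y + t *: d')) - fine (g y)) / t)%:E.
  by move=> t0 zd; rewrite (dom_EFin gp zd) (dom_EFin gp yd).
apply/eqP; rewrite eq_le; apply/andP; split.
  apply: liminf2_le => e e0.
  pose K := normv mu + `|al| + 1; have al0 := normr_ge0 al.
  have K0 : 0 < K by rewrite /K; lra.
  have [|t [d' [/andP[t0 te] de Qe]]] := liminf2_lt lt (e := Num.min e (e / K)).
    by rewrite lt_min e0 divr_gt0.
  move: te de; rewrite !lt_min => /andP[te tK] /andP[de dK].
  exists t, d'; split=> //; first by rewrite t0.
  have t2 : 0 < t ^+ 2 / 2 by rewrite divr_gt0 // exprn_gt0.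
  cbv beta in Qe; have i0 : 0 < (t ^+ 2 / 2)^-1 by rewrite invr_gt0.
  have zd := quot_dom gp yd i0 Qe.
  move: Qe; rewrite quotE // lte_fin ltr_pdivrMr // => Qe.
  rewrite quot1 // lee_fin ler_pdivrMr //.
  have := near _ _ dK; rewrite ler_norml => /andP[_ h].
  have h1 : al * (t ^+ 2 / 2) <= `|al| * (e / K) * t.
    apply: (@le_trans _ _ (`|al| * (t ^+ 2 / 2))); first by rewrite ler_pM2r // ler_norm.
    rewrite -mulrA ler_wpM2l // expr2.
    have := ler_wpM2r (ltW t0) (ltW tK); have : 0 < t * t by rewrite mulr_gt0.
    by lra.
  have : (normv mu + `|al|) * (e / K) <= e.
    by rewrite mulrA ler_pdivrMr // mulrC ler_pM2l // /K lerDl.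
  move=> /(ler_wpM2r (ltW t0)); have := ler_wpM2r (ltW t0) h; lra.
apply: liminf2_ge => eps eps0; exists (eps / (normv mu + 1)) => [|t d' /andP[t0 te] de].
  by rewrite divr_gt0.
have [zd|/ndom_pinfty zoo] := EM (domg g (y + t *: d')).
  rewrite quot1 // lee_fin ler_pdivlMr //.
  have [_ /(_ _ zd)] := (subdiffP gp _ _).1 sub.
  rewrite addrAC subrr add0r dotvZr.
  have := near _ _ de; rewrite ler_norml => /andP[h _].
  have h1 : normv mu * (eps / (normv mu + 1)) <= eps.
    by rewrite mulrA ler_pdivrMr // mulrC ler_pM2l // lerDl.
  have : (dotv mu d - eps) * t <= dotv mu d' * t by rewrite ler_pM2r //; lra.
  lra.
by rewrite zoo (dom_EFin gp yd) gt0_mulye ?leey // lte_fin invr_gt0.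
Qed.

Section SecondOrderGrowth.
Variables (n m : nat) (f0 : vec n -> RR) (gf0 : vec n -> vec n) (Hf0 : vec n -> 'M[RR]_n).
Variables (F : vec n -> vec m) (JF : vec n -> 'M[RR]_(m, n)) (HF : vec n -> 'I_m -> 'M[RR]_n).
Hypotheses (C2f : C2_scalar f0 gf0 Hf0) (C2F : C2_vector F JF HF).
Variable g : vec m -> \bar RR.
Hypotheses (g_proper : proper_fun g) (g_lsc : lsc_fun g) (g_cvx : convex_fun g).
Let gr y := fine (g y).
Variables (x0 : vec n) (mu : vec m) (kappa k0 ell : RR).
Hypothesis consts : [/\ 0 < kappa, 0 < k0 & 0 <= ell].
Hypothesis sub_mu : subdiff g (F x0) mu.
Let J := JF x0.
Let y0 := F x0.
Hypothesis growth : exists2 rho : RR, 0 < rho & forall x, domg g (F x) -> normv (x - x0) < rho ->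
  f0 x0 + gr y0 + dotv (gf0 x0 + J^T *m mu) (x - x0)
    + (2 * kappa)^-1 * dotv (x - x0) (x - x0) <= f0 x + gr (F x).
Hypothesis lip : loc_lip_rel g y0 ell.
Hypothesis metric : exists e : RR, 0 < e /\ forall x', normv (x' - x0) < e ->
  (dist_e x' [set x | (g (F x) < +oo)%E] <= k0%:E * dist_e (F x') (domg g))%E.

(** The slack [eta] stands in for a nearest feasible point, which need not be attained. *)
Lemma metric_real : exists2 e : RR, 0 < e & forall x' y (eta : RR), normv (x' - x0) < e ->
  domg g y -> 0 < eta ->
  exists2 x, domg g (F x) & normv (x' - x) < k0 * normv (F x' - y) + eta.
Proof.
have [_ k00 _] := consts; have [e [e0 he]] := metric; exists e => // x' y eta xe yd eta0.
have h : (dist_e x' [set x | (g (F x) < +oo)%E] < (k0 * normv (F x' - y) + eta)%:E)%E.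
  apply: le_lt_trans (he x' xe) _.
  apply: (@le_lt_trans _ _ (k0%:E * (normv (F x' - y))%:E)%E).
    apply: lee_wpmul2l; first by rewrite lee_fin ltW.
    by apply: ereal_inf_lbound; exists y.
  by rewrite -EFinM lte_fin ltrDl.
by have [_ [x xd <-]] := ereal_inf_lt h; rewrite lte_fin => lt; exists x.
Qed.

Let S := mxsum J.
(** ell + |mu| is a Lipschitz rate of g - <mu, .>, and 1 + S k0 measures how far the metric
    correction moves the linearized arc per unit of residual. *)
Let Cpen := (ell + normv mu) * (1 + S * k0).
(** The value that the second subderivative at J w has to reach. *)
Let alpha w := kappa^-1 * dotv w w - dotv w (hessL Hf0 HF x0 mu *m w).
(** t^2/2 times the parabolic difference quotient minus <mu, s>, once dg(y0)(J w) = <mu, J w> is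
    known. *)
Let q t w s := gr (y0 + t *: (J *m w) + (t ^+ 2 / 2) *: s) - gr y0 - t * dotv mu (J *m w)
  - t ^+ 2 / 2 * dotv mu s.

Lemma q_ge0 t w s : domg g (y0 + t *: (J *m w) + (t ^+ 2 / 2) *: s) -> 0 <= q t w s.
Proof.
move=> zd; have [_ /(_ _ zd)] := (subdiffP g_proper _ _).1 sub_mu.
by rewrite -/y0 addr2K dotvDr !dotvZr /q /gr; lra.
Qed.

Lemma Cpen_ge0 : 0 <= Cpen.
Proof.
have [_ k00 ell0] := consts; apply: mulr_ge0; first exact: addr_ge0.
by rewrite addr_ge0 // mulr_ge0 ?mxsum_ge0 // ltW.
Qed.

(* The metric qualification condition turns the growth of [f] along feasible parabolic
   arcs into an exact penalty estimate along arbitrary ones. *)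
Lemma exact_penalty w (R eps : RR) : 0 <= R -> 0 < eps ->
  exists2 t0 : RR, 0 < t0 & forall t u s, 0 < t -> t < t0 -> normv u <= R -> normv s <= R ->
    domg g (y0 + t *: (J *m w) + (t ^+ 2 / 2) *: s) ->
    (alpha w - Cpen * normv (s - J *m u - hessq HF x0 w) - eps) * (t ^+ 2 / 2) <= q t w s.
Proof.
move=> R0 eps0; have S0 : 0 <= S := mxsum_ge0 _.
have [kappa0 k00 ell0] := consts.
have [rho rho0 hgrow] := growth; have [em em0 hm] := metric_real; have [el [el0 hl]] := lip.
set b := hessq HF x0 w.
have mu0 := normv_ge0 mu; have b0 := normv_ge0 b; have w0 := normv_ge0 w.
have Jw0 := normv_ge0 (J *m w).
pose K := (ell + normv mu) * (S * (k0 + 1)) + 2 + ell + 1.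
have K0 : 0 < K.
  have : 0 <= (ell + normv mu) * (S * (k0 + 1)).
    by apply: mulr_ge0; [lra|apply: mulr_ge0 => //; lra].
  by rewrite /K; lra.
pose e1 := Num.min 1 (eps / K).
have e10 : 0 < e1 by rewrite lt_min ltr01 divr_gt0.
have e11 : e1 <= 1 by rewrite ge_min lexx.
have e1K : K * e1 <= eps by rewrite mulrC -ler_pdivlMr // ge_min lexx orbT.
clearbody e1.
have SR : 0 <= S * R by apply: mulr_ge0.
(* A bound, independent of [t], for the corrected acceleration [u'] constructed below. *)
pose R1 := R + k0 * (R + S * R + normv b + 1) + 1.
have R10 : 0 <= k0 * (R + S * R + normv b + 1) by apply: mulr_ge0; lra.
have R1R : R <= R1 by rewrite /R1; lra.
have R1p : 0 <= R1 by lra.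
have [tF tF0 hF] := taylor_parabola_vec C2F x0 w R1 e10.
have [tf tf0 hf] := taylor_parabola C2f x0 w R1 e10.
have SR1 : 0 <= S * R1 by apply: mulr_ge0.
pose Bd := normv w + R1 + normv (J *m w) + S * R1 + normv b + 2.
have Bd0 : 0 < Bd by rewrite /Bd; lra.
have Bd1 : normv w + R1 <= Bd by rewrite /Bd; lra.
have Bd2 : normv (J *m w) + R <= Bd by rewrite /Bd; lra.
have Bd3 : normv (J *m w) + (S * R1 + normv b) + 1 <= Bd by rewrite /Bd; lra.
clearbody Bd.
have wR0 : 0 <= normv w * R1 by apply: mulr_ge0.
exists (Num.min (Num.min tF tf) (Num.min (Num.min 1 (kappa * e1 / (normv w * R1 + 1)))
   (Num.min (rho / Bd) (Num.min (em / Bd) (el / Bd))))).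
  by rewrite !lt_min tF0 tf0 ltr01 !divr_gt0 ?mulr_gt0 //; lra.
move=> t u s t0; rewrite !lt_min !ltr_pdivlMr //; last lra.
move=> /andP[/andP[tF1 tf1] /andP[/andP[t1 tk] /and3P[trho tem tel]]] uR sR yd.
set tau := t ^+ 2 / 2.
have tau0 : 0 < tau by rewrite divr_gt0 // exprn_gt0.
have tt : tau <= t.
  have : t * t <= t by rewrite ler_piMl // ltW.
  by rewrite /tau expr2; move: t0; lra_goal.
have t2E : t ^+ 2 = 2 * tau by rewrite /tau; field.
have arc v : normv v <= R1 -> normv (t *: w + tau *: v) <= t * (normv w + R1).
  move=> vR; apply: le_trans (ler_normvD _ _) _; rewrite !normvZ !gtr0_norm // mulrDr lerD2l.
  by apply: ler_pM => //; exact: ltW.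
have FB v : normv v <= R1 ->
    normv (F (x0 + (t *: w + tau *: v)) - (y0 + t *: (J *m w) + tau *: (J *m v + b))) <= tau * e1.
  move=> vR; rewrite [tau * e1]mulrC; have := hF t v t0 tF1 vR; congr (normv _ <= _).
  by rewrite !opprD !addrA.
have FBs v : normv v <= R1 ->
    normv (F (x0 + (t *: w + tau *: v)) - (y0 + t *: (J *m w) + tau *: s))
      <= tau * (normv (J *m v + b - s) + e1).
  move=> vR; apply: le_trans (ler_distvD (y0 + t *: (J *m w) + tau *: (J *m v + b)) _ _) _.
  rewrite mulrDr addrC lerD ?FB // opprD addrACA subrr add0r -scalerBr.
  by rewrite normvZ gtr0_norm.
set y := y0 + _ + _ in yd.
set p := s - J *m u - b.
have pE : normv (J *m u + b - s) = normv p.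
  by rewrite -[LHS]normvN opprB opprD addrA.
have JB v : normv v <= R1 -> normv (J *m v) <= S * R1.
  by move=> vR; apply: le_trans (ler_normv_mulmx _ _) _; rewrite ler_wpM2l.
have pR : normv p <= R + S * R + normv b.
  apply: le_trans (ler_normvB _ _) _; rewrite lerD2r.
  apply: le_trans (ler_normvB _ _) _; rewrite lerD //.
  by apply: le_trans (ler_normv_mulmx _ _) _; rewrite ler_wpM2l.
have uR1 : normv u <= R1 := le_trans uR R1R.
have tBd c : c <= Bd -> t * c <= t * Bd by move=> cB; rewrite ler_pM2l.
set xt := x0 + (t *: w + tau *: u).
have xt_near : normv (xt - x0) < em.
  rewrite /xt addrAC subrr add0r; apply: le_lt_trans (arc u uR1) _.
  exact: le_lt_trans (tBd _ Bd1) tem.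
(* The feasible point lies within O(tau) of [xt], hence on a parabolic arc with the same tangent [w]
   and a bounded acceleration [u']. *)
have [x' xd xx] := hm xt y (tau * e1) xt_near yd (mulr_gt0 tau0 e10).
have p0 := normv_ge0 p.
have du : normv (tau^-1 *: (x' - xt)) <= k0 * (normv p + e1) + e1.
  rewrite normvZ gtr0_norm ?invr_gt0 // mulrC ler_pdivrMr // normvC.
  apply/ltW/(lt_le_trans xx); have := FBs u uR1; rewrite pE -/xt -/y => h.
  have := ler_wpM2l (ltW k00) h; lra_goal.
pose u' := u + tau^-1 *: (x' - xt).
have u'R : normv u' <= R1.
  apply: le_trans (ler_normvD _ _) _; rewrite /R1.
  have : k0 * (normv p + e1) <= k0 * (R + S * R + normv b + 1).
    by rewrite ler_pM2l //; apply: lerD.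
  move: uR du e11; lra_goal.
have x'E : x' = x0 + (t *: w + tau *: u').
  rewrite /u' scalerDr scalerA divff ?gt_eqF // scale1r.
  by rewrite [t *: w + _]addrA [RHS]addrA -/xt [RHS]addrC subrK.
have u'u : normv (J *m u' + b - s) <= normv p + S * (k0 * (normv p + e1) + e1).
  have -> : J *m u' + b - s = (J *m u + b - s) + J *m (tau^-1 *: (x' - xt)).
    by rewrite /u' mulmxDr [_ + _ + b]addrAC [LHS]addrAC.
  apply: le_trans (ler_normvD _ _) _; rewrite pE lerD2l.
  by apply: le_trans (ler_normv_mulmx _ _) _; rewrite ler_wpM2l.
clearbody u'.
have y_near : normv (y - y0) < el.
  have -> : y - y0 = t *: (J *m w) + tau *: s by rewrite /y addr2K.
  apply: le_lt_trans (ler_normvD _ _) _; rewrite !normvZ !gtr0_norm //.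
  have : tau * normv s <= t * R by apply: ler_pM => //; exact: ltW.
  have := tBd _ Bd2; move: tel; lra_goal.
have x'_near : normv (F x' - y0) < el.
  have := FB u' u'R; rewrite -x'E => h.
  apply: le_lt_trans (ler_distvD (y0 + t *: (J *m w) + tau *: (J *m u' + b)) _ _) _.
  rewrite addr2K.
  have := ler_normvD (t *: (J *m w)) (tau *: (J *m u' + b)).
  rewrite !normvZ !gtr0_norm //.
  have h1 : tau * normv (J *m u' + b) <= t * (S * R1 + normv b).
    apply: ler_pM => //; first exact: ltW.
    by apply: le_trans (ler_normvD _ _) _; rewrite lerD2r JB.
  have h2 : tau * e1 <= t * 1 by apply: ler_pM => //; exact: ltW.
  have := tBd _ Bd3; move: h h1 h2 tel; lra_goal.
have Fy := FBs u' u'R; rewrite -x'E -/y in Fy.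
have := hl _ _ xd yd x'_near y_near; rewrite ler_norml => /andP[_ hlip].
have {}hlip : gr (F x') - gr y <= ell * (tau * (normv (J *m u' + b - s) + e1)).
  by apply: le_trans hlip _; rewrite ler_wpM2l.
have x'_rho : normv (x' - x0) < rho.
  rewrite x'E addrAC subrr add0r; apply: le_lt_trans (arc u' u'R) _.
  exact: le_lt_trans (tBd _ Bd1) trho.
have hg := hgrow x' xd x'_rho.
have := hf t u' t0 tf1 u'R; rewrite -/tau -x'E ler_norml => /andP[_ hft].
have ax : x' - x0 = t *: w + tau *: u' by rewrite x'E addrAC subrr add0r.
rewrite ax in hg.
have qd : tau * (kappa^-1 * dotv w w - e1) <=
    (2 * kappa)^-1 * dotv (t *: w + tau *: u') (t *: w + tau *: u').
  have h : t ^+ 2 * dotv w w - 2 * (t * (tau * (normv w * R1))) <=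
      dotv (t *: w + tau *: u') (t *: w + tau *: u').
    rewrite !dotvL (dotvC u' w).
    have h1 : 0 <= tau * (tau * dotv u' u') by rewrite !mulr_ge0 // ltW.
    have : `|dotv w u'| <= normv w * R1.
      by apply: le_trans (normr_dotv _ _) _; rewrite ler_wpM2l.
    rewrite ler_norml => /andP[h2 _].
    have h3 : t * (tau * - (normv w * R1)) <= t * (tau * dotv w u') by rewrite !ler_pM2l.
    by rewrite expr2; move: h1 h3; lra_goal.
  have k2 : 0 < (2 * kappa)^-1 by rewrite invr_gt0 mulr_gt0.
  apply: le_trans (ler_wpM2l (ltW k2) h).
  have -> : (2 * kappa)^-1 * (t ^+ 2 * dotv w w - 2 * (t * (tau * (normv w * R1)))) =
    tau * (kappa^-1 * dotv w w - t * (normv w * R1) / kappa).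
    by rewrite t2E; field; rewrite gt_eqF.
  rewrite ler_pM2l // lerD2l lerN2 ler_pdivrMr // mulrC.
  by rewrite mulrC; move: tk t0; lra_goal.
have muq : - (normv mu * normv (J *m u' + b - s)) <=
    dotv mu (J *m u') + dotv mu b - dotv mu s.
  have := normr_dotv mu (J *m u' + b - s); rewrite ler_norml => /andP[+ _].
  by rewrite dotvDr dotvNr dotvDr.
have E1 : dotv (gf0 x0 + J^T *m mu) (t *: w + tau *: u') =
    dotv (gf0 x0) (t *: w + tau *: u') + t * dotv mu (J *m w) + tau * dotv mu (J *m u').
  by rewrite dotvDl dotv_trmx mulmxDr -!scalemxAr (dotvDr mu) !(dotvZr mu) addrA.
rewrite E1 in hg.
have aE : alpha w = kappa^-1 * dotv w w - dotv w (Hf0 x0 *m w) - dotv mu b.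
  by rewrite /alpha dotv_hessL; ring.
rewrite /q -/tau -/y aE.
set X := normv (J *m u' + b - s) in Fy hlip u'u muq.
have X0 : 0 <= X := normv_ge0 _.
have h1 : tau * (- (normv mu * X)) <= tau * (dotv mu (J *m u') + dotv mu b - dotv mu s).
  by rewrite ler_pM2l.
have h2 : (ell + normv mu) * X <= Cpen * normv p + (ell + normv mu) * (S * (k0 + 1)) * e1.
  have -> : Cpen * normv p + (ell + normv mu) * (S * (k0 + 1)) * e1 =
    (ell + normv mu) * (normv p + S * (k0 * (normv p + e1) + e1)) by rewrite /Cpen; ring.
  by rewrite ler_wpM2l ?addr_ge0 //; move: u'u; lra_goal.
have h3 : tau * ((ell + normv mu) * X + (2 + ell) * e1) <= tau * (Cpen * normv p + eps).
  rewrite ler_pM2l //; move: e1K; rewrite /K; move: h2 e10; lra_goal.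
move: hlip hg hft qd h1 h3; lra_goal.
Qed.

Hypothesis single : forall mu', subdiff g y0 mu' -> J^T *m mu' = J^T *m mu -> mu' = mu.

(** Bounded multipliers cluster, the graph of the subdifferential is closed, and uniqueness
    identifies the cluster point with [mu]. *)
Lemma multiplier_near (M eta : RR) : 0 < eta -> exists2 rho : RR, 0 < rho &
  forall y mu', subdiff g y mu' -> normv (y - y0) < rho -> normv (mu' - mu) <= M ->
    normv (J^T *m mu' - J^T *m mu) < rho -> normv (mu' - mu) < eta.
Proof.
move=> eta0; apply: contrapT => hn.
have h k : exists p : vec m * vec m, [/\ subdiff g p.1 p.2, normv (p.1 - y0) < k.+1%:R^-1,
    normv (p.2 - mu) <= M, normv (J^T *m p.2 - J^T *m mu) < k.+1%:R^-1 &
    eta <= normv (p.2 - mu)].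
  apply: contrapT => hk; apply: hn; exists k.+1%:R^-1; first exact: invS_gt0.
  move=> y mu' h1 h2 h3 h4; rewrite ltNge; apply/negP => h5.
  by apply: hk; exists (y, mu').
have [p hp] := choice h.
have pB k : normv (p k).2 <= M + normv mu.
  by have [_ _ h3 _ _] := hp k; rewrite -[(p k).2](subrK mu) (le_trans (ler_normvD _ _)) // lerD2r.
have [s [mu' [hs mucv]]] := bw_vec pB.
have cv_of (l : nat) (v : nat -> vec l) (a : vec l) :
    (forall k, normv (v k - a) < k.+1%:R^-1) -> cvg_vseq (fun k => v (s k)) a.
  move=> hv e /invS_small[N hN]; exists N => k Nk.
  by apply: lt_trans (hv _) (hN _ _); apply: leq_trans Nk (hs k).
have ycv : cvg_vseq (fun k => (p (s k)).1) y0.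
  by apply: (cv_of _ (fun k => (p k).1)) => k; have [_ ? _ _ _] := hp k.
have Jcv : cvg_vseq (fun k => J^T *m (p (s k)).2) (J^T *m mu).
  by apply: (cv_of _ (fun k => J^T *m (p k).2)) => k; have [_ _ _ ? _] := hp k.
have sub' : subdiff g y0 mu'.
  by apply: subdiff_closed g_proper _ _ _ _ g_lsc ycv mucv _ => k; have [? _ _ _ _] := hp (s k).
have JE : J^T *m mu' = J^T *m mu.
  have c := cvgv_sub (cvgv_mulmx (cvgm_cst J^T) mucv) Jcv.
  apply/eqP; rewrite -subr_eq0 -dotvv_eq0 eq_le dotvv_ge0 andbT.
  apply: (cvgr_le (cvgr_dotv c c) (cvgr_cst 0)); exists 0%N => k _.
  by rewrite subrr dotv0r.
have [N hN] := mucv eta eta0; have [_ _ _ _] := hp (s N).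
by rewrite leNgt -(single sub' JE) hN.
Qed.

(** * The regularized penalty problem *)

Section Regularized.
Variables (t del : RR) (w : vec n) (s1 b : vec m).
Hypotheses (t0 : 0 < t) (del0 : 0 < del).
Let tau := t ^+ 2 / 2.
Let a := y0 + t *: (J *m w).

(* The multiplier produced at a minimizer is [mu - p - del *: (s - s1)] with
   [p = s - J *m u - b] and [J^T *m p = del *: u]: it is bounded uniformly in [del] and
   asymptotically satisfies [J^T *m mu' = J^T *m mu]. *)
Definition regQ (u : vec n) (s : vec m) : RR :=
  - (tau * dotv mu s) + tau * (dotv (s - J *m u - b) (s - J *m u - b) / 2
     + del / 2 * (dotv (s - s1) (s - s1) + dotv u u)).
Definition regQu u s : vec n := tau *: (del *: u - J^T *m (s - J *m u - b)).
Definition regQs u s : vec m := tau *: (- mu + (s - J *m u - b) + del *: (s - s1)).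

Lemma regQ_cont uk sk u s : cvg_vseq uk u -> cvg_vseq sk s ->
  cvg_rseq (fun k => regQ (uk k) (sk k)) (regQ u s).
Proof.
move=> hu hs.
have hp := cvgv_sub (cvgv_sub hs (cvgv_mulmx (cvgm_cst J) hu)) (@cvgv_cst _ b).
have hs1 := cvgv_sub hs (@cvgv_cst _ s1).
apply: cvgr_add.
  exact: (cvgr_opp (cvgr_mul (cvgr_cst _) (cvgr_dotv (@cvgv_cst _ _) hs))).
apply: (cvgr_mul (cvgr_cst _)); apply: cvgr_add.
  exact: (cvgr_mul (cvgr_dotv hp hp) (cvgr_cst _)).
exact: (cvgr_mul (cvgr_cst _) (cvgr_add (cvgr_dotv hs1 hs1) (cvgr_dotv hu hu))).
Qed.

Lemma regQ_u u s p : exists d, forall th,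
  regQ (u + th *: p) s = regQ u s + th * dotv (regQu u s) p + th ^+ 2 * d.
Proof.
exists (tau * (dotv (J *m p) (J *m p) / 2 + del / 2 * dotv p p)) => th.
rewrite /regQ /regQu mulmxDr -scalemxAr.
have -> : s - (J *m u + th *: (J *m p)) - b = (s - J *m u - b) - th *: (J *m p).
  by rewrite opprD addrA [LHS]addrAC.
have [c ->] : exists c, s - J *m u - b = c by exists (s - J *m u - b).
have [c' ->] : exists c', s - s1 = c' by exists (s - s1).
have -> : dotv (tau *: (del *: u - J^T *m c)) p = tau * (del * dotv u p - dotv c (J *m p)).
  by rewrite dotvZl dotvDl dotvNl dotvZl dotv_trmx.
by rewrite !dotvL (dotvC p u) (dotvC (J *m p) c); field.
Qed.

Lemma regQ_s u s p : exists d, forall th,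
  regQ u (s + th *: p) = regQ u s + th * dotv (regQs u s) p + th ^+ 2 * d.
Proof.
exists (tau * (dotv p p / 2 + del / 2 * dotv p p)) => th.
rewrite /regQ /regQs.
have -> : s + th *: p - J *m u - b = (s - J *m u - b) + th *: p.
  by rewrite [s + _ - _]addrAC [LHS]addrAC.
have -> : s + th *: p - s1 = (s - s1) + th *: p by rewrite addrAC.
have [c ->] : exists c, s - J *m u - b = c by exists (s - J *m u - b).
have [c' ->] : exists c', s - s1 = c' by exists (s - s1).
by rewrite !dotvL (dotvC p c) (dotvC p c'); field.
Qed.

(** Since [q] is nonnegative, comparison with (0, s1) bounds the penalty by [M0] independently of
    [t]; the regularization then keeps the minimizer strictly inside the ball of radius [rr]. *)
Lemma regularized_minimizer (M0 rr : RR) : 0 < rr -> 2 * M0 / del < rr ^+ 2 ->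
  domg g (a + tau *: s1) ->
  q t w s1 + tau * (dotv (s1 - b) (s1 - b) / 2) <= tau * M0 ->
  exists u s, let p := s - J *m u - b in
  [/\ domg g (a + tau *: s),
      dotv p p / 2 + del / 2 * (dotv (s - s1) (s - s1) + dotv u u) <= M0,
      J^T *m p = del *: u &
      subdiff g (a + tau *: s) (mu - p - del *: (s - s1))].
Proof.
move=> rr0 Mrr s1d qM; have tau0 : 0 < tau by rewrite divr_gt0 // exprn_gt0.
have bound u s : domg g (a + tau *: s) ->
    gr (a + tau *: s) + regQ u s <= gr (a + tau *: s1) + regQ 0 s1 ->
    dotv (s - J *m u - b) (s - J *m u - b) / 2
      + del / 2 * (dotv (s - s1) (s - s1) + dotv u u) <= M0.
  move=> sd; rewrite /regQ mulmx0 subr0 subrr !dotv0r addr0 mulr0 addr0 => le.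
  have := q_ge0 sd; move: qM; rewrite /q -/tau -/a => h1 h2.
  by rewrite -(ler_pM2l tau0); lra.
have sq0 u s : 0 <= dotv (s - J *m u - b) (s - J *m u - b) / 2 by rewrite divr_ge0.
have [||u [s []]] := @joint_opt n m g g_proper g_lsc g_cvx a tau tau0 _ _ _
  regQ_cont regQ_u regQ_s 0 s1 rr rr0 => //.
  move=> u s sd _ le; apply: le_lt_trans Mrr; rewrite ler_pdivlMr // subr0.
  have := bound u s sd le; have := sq0 u s; lra.
move=> sd le _ gu sub; exists u, s; split=> //; first exact: bound le.
- apply/eqP; rewrite eq_sym -subr_eq0; apply/eqP.
  have := congr1 (fun z => tau^-1 *: z) gu.
  by rewrite /regQu scalerA mulVf ?gt_eqF // scale1r scaler0.
- move: sub; rewrite /regQs scalerA mulVf ?gt_eqF // scale1r.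
  by rewrite !opprD opprK.
Qed.

End Regularized.

Hypothesis preg : parabolic_regular g y0 mu.

(** If the inequality fails, parabolic regularity yields a parabolic direction whose quotient is too
    small. The penalty problem started there has a minimizer with small residual, at which
    [exact_penalty] contradicts the small value. *)
Lemma second_order_growth w :
  ((kappa^-1 * dotv w w)%:E
     <= (dotv w (hessL Hf0 HF x0 mu *m w))%:E + d2sub g y0 mu (J *m w))%E.
Proof.
suff h : ((alpha w)%:E <= d2sub g y0 mu (J *m w))%E.
  apply: le_trans (leeD (lexx _) h); rewrite -EFinD lee_fin /alpha; lra.
rewrite leNgt; apply/negP => lt; set d := J *m w in lt.
have y0d := subdiff_dom g_proper sub_mu.
have dE := subderivE g_proper sub_mu lt.
have [al' [s1 [al'lt s1lt]]] : exists al' s1, al' < alpha w /\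
    (liminf2 (par_quot g y0 d) s1 < (al' + dotv mu s1)%:E)%E.
  move: (lt); rewrite -preg; last exact: lt_trans lt (ltry _).
  move=> /ereal_inf_lt[_ [s1 _ <-]]; rewrite /d2par dE /=.
  case E: (liminf2 _ s1) => [v| |] //.
    rewrite -EFinB lte_fin => vlt; exists ((v - dotv mu s1 + alpha w) / 2), s1.
    by rewrite E lte_fin; split; lra.
  by move=> _; exists (alpha w - 1), s1; rewrite E ltNyr; split=> //; lra.
set b := hessq HF x0 w.
(* The gap between al' and alpha is halved: one half pays for replacing [s1] by a nearby [s'], the
   other half [G] is left for the contradiction. *)
pose al2 := (alpha w + al') / 2; pose G := alpha w - al2.
have G0 : 0 < G by rewrite /G /al2; lra.
pose Bp := normv (s1 - b) + 1; have Bp0 : 1 <= Bp by rewrite lerDr.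
(* Bounds al2 + |s' - b|^2 / 2, the scaled energy of the starting point (0, s'). *)
pose M0 := `|al2| + Bp ^+ 2; have M00 : 0 <= M0 by rewrite addr_ge0 ?sqr_ge0.
have C0 := Cpen_ge0; have S0 : 0 <= S := mxsum_ge0 _.
have CB : 0 < 8 * (Cpen + Bp) by lra.
(* With |p| <= 2 eta the two terms linear in |p| cost at most G/4; [exact_penalty] costs another
   G/4. *)
pose eta := G / (8 * (Cpen + Bp)); have eta0 : 0 < eta by rewrite divr_gt0.
have etaG : 8 * (Cpen + Bp) * eta = G by rewrite mulrC divfK // gt_eqF.
have [rho rho0 hrho] := multiplier_near (2 * M0 + 1 + eta) eta0.
(* Bounds |del u| and |del (s - s')|; hence J^T changes the multiplier's image by at most (1 + S)
   sig, which is below [rho]. *)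
pose sig := Num.min eta (rho / (2 * (1 + S))).
have S1 : 0 < 2 * (1 + S) by lra.
have sig0 : 0 < sig by rewrite lt_min eta0 divr_gt0.
have sig1 : sig <= eta by rewrite ge_min lexx.
have sig2 : sig * (2 * (1 + S)) <= rho by rewrite -ler_pdivlMr // ge_min lexx orbT.
(* From del |v|^2 <= 2 M0 this yields |del v|^2 <= 2 M0 del <= sig^2. *)
pose del := Num.min 1 (sig ^+ 2 / (2 * M0 + 1)).
have M01 : 0 < 2 * M0 + 1 by lra.
have del0 : 0 < del by rewrite lt_min ltr01 divr_gt0 // exprn_gt0.
have del1 : del * (2 * M0 + 1) <= sig ^+ 2 by rewrite -ler_pdivlMr // ge_min lexx orbT.
clearbody eta sig del.
pose R2 := 2 * M0 / del; have R20 : 0 <= R2.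
  by rewrite divr_ge0 ?(ltW del0) // mulr_ge0.
pose rr := R2 + 1; have rr0 : 0 < rr by rewrite /rr; lra.
have rr2 : R2 < rr ^+ 2 by rewrite /rr sqrrD expr1n mulr1 mulr2n; have := sqr_ge0 R2; lra.
pose R := rr + normv s1 + 1; have s10 := normv_ge0 s1; have R0 : 0 <= R by rewrite /R; lra.
have G4 : 0 < G / 4 by lra.
have [t0 t00 hpen] := exact_penalty w R0 G4.
have d0 := normv_ge0 d; have mu0 := normv_ge0 mu.
have dR : 0 < normv d + R + 1 by lra.
pose e := Num.min (Num.min t0 1) (Num.min (G / (normv mu + 1)) (rho / (normv d + R + 1))).
have [|t [s' [/andP[t0' te] se Qe]]] := liminf2_lt s1lt (e := e).
  by rewrite !lt_min t00 ltr01 !divr_gt0 //; lra.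
have mu1 : 0 < normv mu + 1 by rewrite ltr_wpDl.
move: te se; rewrite /e !lt_min !ltr_pdivlMr //.
move=> /andP[/andP[tt0 t1] /andP[_ trho]] /andP[/andP[_ s'1] /andP[s'mu _]].
set tau := t ^+ 2 / 2; have tau0 : 0 < tau by rewrite divr_gt0 // exprn_gt0.
have i0 : 0 < tau^-1 by rewrite invr_gt0.
have s'd : domg g (y0 + t *: d + tau *: s') := quot_dom g_proper y0d i0 Qe.
have qs' : q t w s' <= tau * al2.
  move: Qe; rewrite /par_quot dE quotE // lte_fin ltr_pdivrMr // -/tau /q -/tau -/d /gr /=.
  have h : dotv mu s1 - dotv mu s' <= G.
    rewrite -dotvNr -dotvDr; apply: le_trans (dotv_le _ _) _.
    by move: s'mu; rewrite normvC; have := normv_ge0 (s' - s1); lra_goal.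
  have : tau * (al' + dotv mu s1) <= tau * (al2 + dotv mu s').
    by rewrite ler_pM2l //; move: h; rewrite /G /al2; lra_goal.
  lra_goal.
have s'b : normv (s' - b) <= Bp.
  by apply: le_trans (ler_distvD s1 _ _) _; rewrite /Bp addrC lerD2l ltW.
have [||u [s []]] := @regularized_minimizer t del w s' b t0' del0 M0 rr rr0 rr2 => //.
  rewrite -/tau; have : tau * (dotv (s' - b) (s' - b) / 2) <= tau * Bp ^+ 2.
    rewrite ler_pM2l //; have : dotv (s' - b) (s' - b) <= Bp ^+ 2.
      by rewrite -normv_le // (le_trans ler01).
    by have := sqr_ge0 Bp; lra_goal.
  have : tau * al2 <= tau * `|al2| by rewrite ler_pM2l // ler_norm.
  by rewrite /M0; move: qs'; lra_goal.
rewrite -/tau -/d => sd pM Jp sub.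
have [p pE] : exists p, p = s - J *m u - b by exists (s - J *m u - b).
rewrite -pE in pM Jp sub.
have [z zE] : exists z, z = s - s' by exists (s - s').
rewrite -zE in pM sub.
have pp := dotvv_ge0 p; have zz := dotvv_ge0 z; have uu := dotvv_ge0 u.
have dzz : 0 <= del * dotv z z by rewrite mulr_ge0 // ltW.
have duu : 0 <= del * dotv u u by rewrite mulr_ge0 // ltW.
have small (v : RR) : 0 <= v -> del * v <= 2 * M0 -> v <= R2 /\ del * (del * v) <= sig ^+ 2.
  move=> v0 dv; split; first by rewrite ler_pdivlMr // mulrC.
  by apply: le_trans del1; rewrite ler_pM2l //; apply: le_trans dv _; rewrite lerDl.
have zM : del * dotv z z <= 2 * M0 by move: pM pp duu; lra_goal.
have uM : del * dotv u u <= 2 * M0 by move: pM pp dzz; lra_goal.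
have [z1 z2] := small _ zz zM; have [u1 u2] := small _ uu uM.
have norm_small k (v : vec k) : del * (del * dotv v v) <= sig ^+ 2 -> normv (del *: v) <= sig.
  by move=> h; rewrite normv_le ?(ltW sig0) // !dotvL.
have norm_rr k (v : vec k) : dotv v v <= R2 -> normv v <= rr.
  by move=> h; rewrite normv_le ?(ltW rr0) //; apply: le_trans h (ltW rr2).
have dz := norm_small _ _ z2; have du := norm_small _ _ u2.
have uR : normv u <= R by have := norm_rr _ _ u1; rewrite /R; move: s10; lra_goal.
have sR : normv s <= R.
  have -> : s = z + (s1 + (s' - s1)) by rewrite zE [s1 + _]addrC subrK subrK.
  apply: le_trans (ler_normvD _ _) _.
  have := ler_normvD s1 (s' - s1); have := norm_rr _ _ z1; rewrite /R; move: s'1; lra_goal.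
have muE : mu - p - del *: z - mu = - (p + del *: z).
  by rewrite opprD addrC !addrA addNr add0r.
have p_small : normv p <= 2 * M0 + 1.
  have [p1|p1] := leP (normv p) 1; first by rewrite (le_trans p1) // lerDr mulr_ge0.
  have : normv p * normv p <= 2 * M0 by rewrite -expr2 normv_sqr; move: pM dzz duu; lra_goal.
  have : normv p <= normv p * normv p by rewrite ler_peMr // ltW.
  lra_goal.
have xi : normv (- (p + del *: z)) < eta.
  rewrite -muE; apply: (hrho _ _ sub).
  - have -> : y0 + t *: d + tau *: s - y0 = t *: d + tau *: s by rewrite addr2K.
    apply: le_lt_trans (ler_normvD _ _) _; rewrite !normvZ !gtr0_norm //.
    have tt : tau <= t.
      have : t * t <= t by rewrite ler_piMl // ltW.
      by rewrite /tau expr2; move: t0'; lra_goal.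
    have : tau * normv s <= t * R by apply: ler_pM => //; exact: ltW.
    by move: trho; move: t0'; lra_goal.
  - by rewrite muE normvN; apply: le_trans (ler_normvD _ _) _; move: p_small dz sig1; lra_goal.
  - rewrite -mulmxBr muE mulmxN normvN mulmxDr Jp.
    apply: le_lt_trans (ler_normvD _ _) _.
    have ST : mxsum J^T = S.
      rewrite /S /mxsum exchange_big /=; apply: eq_bigr => i _; apply: eq_bigr => j _.
      by rewrite mxE.
    have := ler_normv_mulmx J^T (del *: z); rewrite ST.
    have := ler_wpM2l S0 dz; move: du sig2 sig0 rho0; lra_goal.
have p_eta : normv p <= 2 * eta.
  have -> : p = - (- (p + del *: z)) - del *: z by rewrite opprK addrK.
  by apply: le_trans (ler_normvB _ _) _; rewrite normvN; move: xi dz sig1; lra_goal.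
have pen := hpen t u s t0' tt0 uR sR sd; rewrite -pE -/tau in pen.
have [_ /(_ _ s'd)] := (subdiffP g_proper _ _).1 sub.
rewrite opprD addrACA subrr add0r -scalerBr.
have -> : s' - s = - z by rewrite zE opprB.
rewrite dotvZr dotvNr => sg.
have xz : dotv (mu - p - del *: z) z = dotv mu s - dotv mu s' - dotv p z - del * dotv z z.
  by rewrite !dotvDl !dotvNl dotvZl {1}zE dotvDr dotvNr; ring.
have pz : dotv p z = dotv p p + del * dotv u u - dotv p (s' - b).
  have -> : z = p + J *m u - (s' - b).
    have [c cE] : exists c, c = J *m u by exists (J *m u).
    by rewrite zE pE -cE; apply/colP => i; rewrite !mxE; ring.
  by rewrite dotvDr dotvNr dotvDr -dotv_trmx Jp dotvZl.
have pB : dotv p (s' - b) <= normv p * Bp.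
  by apply: le_trans (dotv_le _ _) _; rewrite ler_wpM2l.
(* The subgradient inequality of the new multiplier, taken from [s] to [s']. By J^T p = del u the
   squares in <p, s - s'> are nonnegative, and only <p, s' - b> is lost. *)
have qq : q t w s - tau * (normv p * Bp) <= q t w s'.
  have : tau * dotv p z >= tau * (- (normv p * Bp)) by rewrite ler_pM2l // pz; move: pp duu pB; lra_goal.
  have : 0 <= tau * (del * dotv z z) by rewrite mulr_ge0 // ltW.
  move: sg; rewrite xz /q -/tau -/d /gr; lra_goal.
have : tau * (alpha w - Cpen * normv p - G / 4 - normv p * Bp) <= tau * al2.
  by move: pen qq qs'; lra_goal.
rewrite ler_pM2l // => fin.
have : normv p * (Cpen + Bp) <= 2 * eta * (Cpen + Bp).
  by rewrite ler_wpM2r // addr_ge0 // (le_trans ler01).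
move: fin etaG G0; rewrite /G; lra_goal.
Qed.

End SecondOrderGrowth.

(** * Passage to the limit *)

Lemma has_deriv_cvg n p (G : vec n -> vec p) x A (xk : nat -> vec n) :
  has_deriv_at G x A -> cvg_vseq xk x -> cvg_vseq (fun k => G (xk k)) (G x).
Proof.
move=> hG xkx e e0; have [d [d0 hd]] := hG 1 ltr01.
have B0 : 0 < 2 + mxsum A by have := mxsum_ge0 A; lra.
have [|N hN] := xkx (Num.min d (e / (2 + mxsum A))); first by rewrite lt_min d0 divr_gt0.
exists N => k /hN; rewrite lt_min ltr_pdivlMr // => /andP[kd ke].
have := hd _ kd; rewrite [x + _]addrC subrK mul1r => h.
rewrite -[G (xk k) - G x](subrK (A *m (xk k - x))).
apply: le_lt_trans (ler_normvD _ _) _.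
have := ler_normv_mulmx A (xk k - x); have := normv_ge0 (xk k - x); lra.
Qed.

Lemma contv_cvg n (h : vec n -> RR) x (xk : nat -> vec n) :
  contv h x -> cvg_vseq xk x -> cvg_rseq (fun k => h (xk k)) (h x).
Proof.
move=> hc xkx e e0; have [d [d0 hd]] := hc e e0; have [N hN] := xkx d d0.
by exists N => k /hN/hd.
Qed.

Lemma hessL_entry n m Hf0 (HF : vec n -> 'I_m -> 'M[RR]_n) x mu i j :
  hessL Hf0 HF x mu i j = Hf0 x i j + \sum_(l < m) mu l 0 * HF x l i j.
Proof. by rewrite !mxE summxE; congr (_ + _); apply: eq_bigr => l _; rewrite mxE. Qed.

Lemma leq_sum6 (a b c d e f k : nat) : (a + b + c + d + e + f <= k)%N ->
  [/\ (a <= k)%N, (b <= k)%N & (c <= k)%N] /\ [/\ (d <= k)%N, (e <= k)%N & (f <= k)%N].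
Proof. by move=> h; split; split; lia. Qed.

Section TiltStable.
Variables (n m : nat) (f0 : vec n -> RR) (gf0 : vec n -> vec n) (Hf0 : vec n -> 'M[RR]_n).
Variables (F : vec n -> vec m) (JF : vec n -> 'M[RR]_(m, n)) (HF : vec n -> 'I_m -> 'M[RR]_n).
Variables (g : vec m -> \bar RR) (xb : vec n) (kappa : RR).
Let gr y := fine (g y).

(** The Taylor constants and the bound [B] on multipliers make each gradient of the Lagrangian a
    proximal subgradient with one constant [r]. Near (xb, 0), [tilt_inverse] then identifies [x] as
    the minimizer for this tilt, and [tilt_growth] applies. *)
Lemma tilt_stable_growth : C2_scalar f0 gf0 Hf0 -> C2_vector F JF HF -> proper_fun g ->
  domg g (F xb) -> 0 < kappa ->
  tilt_stable (fun x => ((f0 x)%:E + g (F x))%E) xb kappa ->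
  forall B : RR, 0 <= B -> exists2 zeta : RR, 0 < zeta & forall x mu,
  normv (x - xb) < zeta -> normv mu <= B -> subdiff g (F x) mu ->
  normv (gf0 x + (JF x)^T *m mu) < zeta ->
  exists2 rho : RR, 0 < rho & forall x', domg g (F x') -> normv (x' - x) < rho ->
    f0 x + gr (F x) + dotv (gf0 x + (JF x)^T *m mu) (x' - x)
      + (2 * kappa)^-1 * dotv (x' - x) (x' - x) <= f0 x' + gr (F x').
Proof.
move=> C2f C2F gp xbd kappa0 [delta [delta0 [e [e0 [M [MS [Mlip M0]]]]]]] B B0.
have Mxb : M 0 = xb.
  have : Mdelta (fun x => ((f0 x)%:E + g (F x))%E) xb delta 0 (M 0).
    by rewrite MS ?normv0.
  by rewrite M0.
have [r1 [K1 [r10 K10 hK1]]] := C2_quad_bound C2f xb.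
have [r2 [K2 [r20 K20 hK2]]] := C2_vec_quad_bound C2F xb.
(* The ball is shrunk so that the Taylor bounds hold on it; [e'] below is chosen so that [M] still
   maps into the smaller ball. *)
pose del := Num.min delta (Num.min (r1 / 2) (r2 / 2)).
have del0 : 0 < del by rewrite !lt_min delta0 !divr_gt0.
have del_delta : del <= delta by rewrite ge_min lexx.
have del_r1 : del < r1.
  by apply: (@le_lt_trans _ _ (r1 / 2)); [rewrite !ge_min lexx !orbT|lra].
have del_r2 : del < r2.
  by apply: (@le_lt_trans _ _ (r2 / 2)); [rewrite !ge_min lexx !orbT|lra].
clearbody del.
pose e' := Num.min e (del / kappa).
have e'0 : 0 < e' by rewrite lt_min e0 divr_gt0.
have e'e (u : vec n) : normv u < e' -> normv u < e by rewrite lt_min => /andP[].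
pose D : set (vec n) := [set x | normv (x - xb) <= del /\ domg g (F x)].
pose phi x := f0 x + gr (F x).
have xbD : D xb by split=> //; rewrite subrr normv0 ltW.
have Mnear u : normv u < e' -> normv (M u - xb) <= kappa * normv u.
  move=> ue; have h0 : normv (0 : vec n) < e by rewrite normv0.
  by have := Mlip u 0 (e'e u ue) h0; rewrite subr0 Mxb.
have Mball u : normv u < e' -> normv (M u - xb) <= del.
  move=> ue; apply: le_trans (Mnear u ue) _; move: ue.
  by rewrite lt_min ltr_pdivlMr // mulrC => /andP[_ /ltW].
have Mspec u : normv u < e' -> Mdelta (fun x => ((f0 x)%:E + g (F x))%E) xb delta u (M u).
  by move=> ue; rewrite MS ?e'e.
have MD u : normv u < e' -> D (M u).
  move=> ue; split; first exact: Mball.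
  have [_ /(_ xb)] := Mspec u ue; rewrite subrr normv0 => /(_ (ltW delta0)).
  move=> h; apply: contrapT => /ndom_pinfty oo; move: h.
  by rewrite oo (dom_EFin gp xbd) addey // addye // addye.
have Mmin u x : normv u < e' -> D x -> phi (M u) - dotv u (M u) <= phi x - dotv u x.
  move=> ue [xr xd]; have [_ /(_ x (le_trans xr del_delta))] := Mspec u ue.
  rewrite (dom_EFin gp xbd) (dom_EFin gp xd) (dom_EFin gp (MD u ue).2).
  by rewrite -!EFinD lee_fin !dotvDr /phi /gr; lra.
have Mlip' u u' : normv u < e' -> normv u' < e' ->
    normv (M u - M u') <= kappa * normv (u - u').
  by move=> ue ue'; apply: Mlip; apply: e'e.
(* r/2 dominates the Taylor errors of [f0] and of <mu, F>. *)
pose r := 2 * (K1 + B * K2) + 1.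
have BK : 0 <= B * K2 by apply: mulr_ge0.
have r0 : 0 < r by rewrite /r; lra.
have rk : 0 < r * (kappa + 1) by apply: mulr_gt0 => //; lra.
(* The last bound gives r (kappa |xs| + |x - xb|) < e'/2, the smallness required by
   [tilt_inverse]. *)
pose zeta := Num.min (del / 2) (Num.min (e' / 2) (e' / 2 / (r * (kappa + 1)))).
exists zeta => [|x mu xz muB sub xsz]; first by rewrite !lt_min !divr_gt0.
set xs := gf0 x + _ in xsz *.
have xd := subdiff_dom gp sub.
move: xz xsz; rewrite !lt_min !ltr_pdivlMr // => /and3P[x1 x2 x3] /and3P[s1 s2 s3].
have xD : D x by split=> //; lra.
have xse : normv xs < e' / 2 by rewrite ltr_pdivlMr.
have xse' : normv xs < e' by lra.
have inv : M xs = x.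
  apply: (@tilt_inverse n phi D M e' kappa e'0 kappa0 MD Mmin Mlip' r x xs r0 xD xse).
    move=> x' [x'r x'd]; set a := x' - x; have x'E : x' = x + a by rewrite /a addrC subrK.
    have a0 := dotvv_ge0 a.
    have xr : normv (x - xb) <= del := xD.1.
    have := hK1 x a (le_lt_trans xr del_r1); rewrite -x'E => /(_ (le_lt_trans x'r del_r1)).
    rewrite ler_norml => /andP[h1 _].
    have := hK2 x a (le_lt_trans xr del_r2); rewrite -x'E => /(_ (le_lt_trans x'r del_r2)) h2.
    have [_ /(_ _ x'd)] := (subdiffP gp _ _).1 sub.
    have h3 : - (B * (K2 * dotv a a)) <= dotv mu (F x' - F x - JF x *m a).
      have : `|dotv mu (F x' - F x - JF x *m a)| <= B * (K2 * dotv a a).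
        by apply: le_trans (normr_dotv _ _) _; apply: ler_pM.
      by rewrite ler_norml => /andP[].
    move: h3; rewrite dotvDr dotvNr -dotv_trmx.
    have -> : dotv xs a = dotv (gf0 x) a + dotv ((JF x)^T *m mu) a by rewrite dotvDl.
    have -> : r / 2 * dotv a a = K1 * dotv a a + B * (K2 * dotv a a) + dotv a a / 2.
      by rewrite /r; field.
    rewrite /phi /gr; lra.
  have h : normv (M xs - x) <= kappa * normv xs + normv (x - xb).
    apply: le_trans (ler_distvD xb _ _) _; rewrite [normv (xb - x)]normvC.
    by rewrite lerD2r Mnear.
  have h' : r * normv (M xs - x) <= r * (kappa * normv xs + normv (x - xb)).
    by rewrite ler_pM2l.
  apply: le_lt_trans h' _.
  have : kappa * (normv xs * (r * (kappa + 1)) * 2) < kappa * e' by rewrite ltr_pM2l.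
  move=> k1; rewrite -(ltr_pM2r (_ : 0 < 2 * (kappa + 1))); last by lra.
  lra.
have [rho rho0 hrho] := @tilt_growth n phi D M e' kappa kappa0 MD Mmin Mlip' xs xse'.
rewrite inv in hrho.
exists (Num.min rho (del / 2)) => [|x' x'd]; first by rewrite lt_min rho0 divr_gt0.
rewrite lt_min => /andP[xr xr2]; apply: hrho => //; split=> //.
by apply: le_trans (ler_distvD x _ _) _; lra.
Qed.

End TiltStable.

Unset Implicit Arguments.

Theorem theorem4p6 (n m : nat)
    (f0 : vec n -> RR) (gf0 : vec n -> vec n) (Hf0 : vec n -> 'M[RR]_n)
    (F : vec n -> vec m) (JF : vec n -> 'M[RR]_(m, n))
    (HF : vec n -> 'I_m -> 'M[RR]_n)
    (g : vec m -> \bar RR) (xb : vec n) (kappa k0 ell : RR)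
    (Wbar : vec m -> 'M[RR]_m) :
  (* smoothness and convexity data *)
  C2_scalar f0 gf0 Hf0 ->
  C2_vector F JF HF ->
  lsc_fun g -> proper_fun g -> convex_fun g ->
  (* xb in dom (g o F), tilt-stable minimizer of f = f0 + g o F, modulus kappa *)
  (g (F xb) < +oo)%E ->
  0 < kappa ->
  tilt_stable (fun x => ((f0 x)%:E + g (F x))%E) xb kappa ->
  (* KKT *)
  (exists mu, subdiff g (F xb) mu /\ gf0 xb + (JF xb)^T *m mu = 0) ->
  (* (1) parabolic regularity / epi-differentiability near xb *)
  (exists e : RR, 0 < e /\ forall x, normv (x - xb) < e ->
     forall mu, subdiff g (F x) mu ->
       parabolic_regular g (F x) mu /\
       (forall d, subderiv g (F x) d = (dotv mu d)%:E -> parabolic_epi g (F x) d)) ->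
  (* (2) relative Lipschitz continuity and metric qualification *)
  0 <= ell -> loc_lip_rel g (F xb) ell ->
  0 < k0 ->
  (exists e : RR, 0 < e /\ forall x', normv (x' - xb) < e ->
     (dist_e x' [set x | (g (F x) < +oo)%E] <= k0%:E * dist_e (F x') (domg g))%E) ->
  (* (3) the matrices Wbar mu *)
  (forall mu, subdiff g (F xb) mu ->
     Bsub (proxf g) (F xb + mu) (Wbar mu) /\
     union_rge g (F xb + mu) = rge (Wbar mu) /\
     forall y, union_rge g (F xb + mu) y ->
       exists zb, y = Wbar mu *m zb /\
         Gamma g (F xb) mu y = (dotv y (zb - y))%:E /\
         dotv y (zb - y) = dotv y ((mpinv (Wbar mu) - 1%:M) *m y)) ->
  (* (4) approximation assumption *)
  (forall (w : vec n) (mu : vec m) (v : vec n),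
     w != 0 -> Kcone F JF g xb (- gf0 xb) w ->
     LambdaV F JF HF g xb (- gf0 xb) w mu ->
     normv mu <= tau JF k0 ell xb (- gf0 xb) ->
     domGamma g (F xb) mu (JF xb *m v) ->
     exists (xk : nat -> vec n) (muk : nat -> vec m) (zk : nat -> vec m)
            (vk : nat -> vec n),
       cvg_vseq xk xb /\ cvg_vseq muk mu /\
       (forall k, subdiff g (F (xk k)) (muk k)) /\
       cvg_vseq zk ((mpinv (Wbar mu) - 1%:M) *m (JF xb *m v)) /\
       cvg_vseq vk v /\
       (forall k, reg_normal (gph_subdiff g) (F (xk k), muk k)
                             (zk k, - (JF (xk k) *m vk k))) /\
       (forall k, exists mu0,
          Lambda F JF g (xk k) ((JF (xk k))^T *m muk k) = [set mu0])) ->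
  (* conclusion *)
  forall mu : vec m,
    (exists w : vec n, w != 0 /\ Kcone F JF g xb (- gf0 xb) w /\
                       LambdaV F JF HF g xb (- gf0 xb) w mu) ->
    normv mu <= tau JF k0 ell xb (- gf0 xb) ->
    forall v : vec n, v != 0 ->
      union_rge g (F xb + mu) (JF xb *m v) ->
      ((kappa^-1 * normv v ^+ 2)%:E
         <= (dotv v (hessL Hf0 HF xb mu *m v))%:E + Gamma g (F xb) mu (JF xb *m v))%E.
Proof.
move=> C2f C2F lsc gp cvx xbd kappa0 tilt _ [ep [ep0 hpar]] ell0 [el [el0 lip]] k00
  [em [em0 met]] hW happ mu [w [w0 [Kw Lw]]] mu_tau v v0 v_rge.
have [[sub muE] _] := Lw.
(* Assumption (3) makes [Gamma] finite, which opens assumption (4), and writes it with the same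
   vector (Wbar^+ - I) J v that is the limit of [zk]. *)
have [_ [_ /(_ _ v_rge)]] := hW mu sub.
move=> [zb [_ [GE zbE]]].
have vdom : domGamma g (F xb) mu (JF xb *m v) by rewrite /domGamma /= GE.
have [xk [muk [zk [vk [xcv [mucv [subk [zcv [vcv [nrmk lamk]]]]]]]]]] :=
  happ w mu v w0 Kw Lw mu_tau vdom.
rewrite GE zbE -EFinD lee_fin normv_sqr [dotv (JF xb *m v) _]dotvC.
have [fG [fH fC]] := C2f; have [FJ [JH FC]] := C2F.
have gcv := has_deriv_cvg (fH xb) xcv.
have Fcv := has_deriv_cvg (FJ xb) xcv.
have Jcv : cvg_mseq (fun k => JF (xk k)) (JF xb).
  move=> i j; have /cvg_vseqP/(_ j) := has_deriv_cvg (JH xb i) xcv.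
  by rewrite !mxE => h e e0; have [N hN] := h e e0; exists N => k /hN; rewrite !mxE.
have JTcv : cvg_mseq (fun k => (JF (xk k))^T) (JF xb)^T.
  by move=> i j e e0; have [N hN] := Jcv j i e e0; exists N => k /hN; rewrite !mxE.
have Hcv : cvg_mseq (fun k => hessL Hf0 HF (xk k) (muk k)) (hessL Hf0 HF xb mu).
  move=> i j; have /cvg_vseqP mui := mucv; rewrite hessL_entry.
  have h := cvgr_add (contv_cvg (fC xb i j) xcv)
    (cvgr_sum (fun l => cvgr_mul (mui l) (contv_cvg (FC xb l i j) xcv))).
  by move=> e e0; have [N hN] := h e e0; exists N => k /hN; rewrite hessL_entry.
have xscv := cvgv_add gcv (cvgv_mulmx JTcv mucv).
(* As [mu] is a multiplier for - gf0 xb, the Lagrangian gradients at (xk, muk) tend to 0 and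
   eventually enter the region of uniform growth. *)
rewrite -muE subrr in xscv.
have B0 : 0 <= normv mu + 1 by rewrite addr_ge0.
have [zeta zeta0 hz] := tilt_stable_growth C2f C2F gp xbd kappa0 tilt B0.
have [N1 h1] := xcv _ zeta0; have [N2 h2] := xscv _ zeta0.
have [N3 h3] := mucv _ ltr01; have [N4 h4] := xcv _ ep0.
have el2 : 0 < el / 2 by lra.
have em2 : 0 < em / 2 by lra.
have [N5 h5] := Fcv _ el2; have [N6 h6] := xcv _ em2.
pose N := (N1 + N2 + N3 + N4 + N5 + N6)%N.
have JFv := cvgr_dotv zcv (cvgv_mulmx Jcv vcv).
apply: (cvgr_le (cvgr_mul (cvgr_cst kappa^-1) (cvgr_dotv vcv vcv))
  (cvgr_add (cvgr_dotv vcv (cvgv_mulmx Hcv vcv)) JFv)).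
exists N => k /leq_sum6[[k1 k2 k3] [k4 k5 k6]].
have muB : normv (muk k) <= normv mu + 1.
  rewrite -[muk k](subrK mu) addrC; apply: le_trans (ler_normvD _ _) _.
  by rewrite lerD2l ltW // h3.
have xsk : normv (gf0 (xk k) + (JF (xk k))^T *m muk k) < zeta.
  by have := h2 k k2; rewrite subr0.
have gk := hz (xk k) (muk k) (h1 k k1) muB (subk k) xsk.
have [preg _] := hpar (xk k) (h4 k k4) (muk k) (subk k).
have [mu0 lamE] := lamk k.
have single mu' : subdiff g (F (xk k)) mu' ->
    (JF (xk k))^T *m mu' = (JF (xk k))^T *m muk k -> mu' = muk k.
  move=> s' JE.
  have : Lambda F JF g (xk k) ((JF (xk k))^T *m muk k) mu' by split.
  have : Lambda F JF g (xk k) ((JF (xk k))^T *m muk k) (muk k) by split.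
  by rewrite lamE => -> ->.
(* Halved radii transfer the Lipschitz and metric conditions from [xb] to [xk k] with unchanged
   constants. *)
have lipk : loc_lip_rel g (F (xk k)) ell.
  exists (el / 2); split=> // y y' yd yd' yr yr'.
  have Fk := h5 k k5.
  apply: lip => //; apply: le_lt_trans (ler_distvD (F (xk k)) _ _) _; lra.
have metk : exists e : RR, 0 < e /\ forall x', normv (x' - xk k) < e ->
    (dist_e x' [set x | (g (F x) < +oo)%E] <= k0%:E * dist_e (F x') (domg g))%E.
  exists (em / 2); split=> // x' xr; have xkr := h6 k k6.
  by apply: met; apply: le_lt_trans (ler_distvD (xk k) _ _) _; lra.
have sog := @second_order_growth n m f0 gf0 Hf0 F JF HF C2f C2F g gp lsc cvx (xk k) (muk k)
  kappa k0 ell (And3 kappa0 k00 ell0) (subk k) gk lipk metk single preg.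
exact: (@normal_cone_growth n m g gp lsc cvx (F (xk k)) (muk k) (JF (xk k)) _ kappa
  (subk k) sog (zk k) (vk k) (nrmk k)).
Qed.
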